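(* Let $(A,\mathfrak m)$ be an analytically unramified Cohen-Macaulay local ring of dimension $d\geq 1$ whose residue field $A/\mathfrak m$ is uncountable or perfect. Let $I$ be an $\mathfrak m$-primary ideal and let $\mathcal F=\{I_n\}_{n\in\mathbb Z}$ be an $I$-admissible filtration with $I_1=\overline I$ and $I_n=\overline{I^n}$ for all $n\gg0$. Let $M,N$ be maximal Cohen-Macaulay $A$-modules. Assume further that $A$ has characteristic $p>0$ and contains a field $k\cong A/\mathfrak m$. If $\operatorname{Ext}^1_A(M,N)\neq T_{\mathcal F}(M,N)$, then the function $e^T_{\mathcal F}\colon\operatorname{Ext}^1_A(M,N)\to\mathbb N$ factors as a function $$[\overline{e^T_{\mathcal F}}]\colon\mathbb P\bigl(\operatorname{Ext}^1_A(M,N)/T_{\mathcal F}(M,N)\bigr)\to\mathbb N\setminus\{0\},$$ i.e. for every $\alpha\in\operatorname{Ext}^1_A(M,N)\setminus T_{\mathcal F}(M,N)$ the value $e^T_{\mathcal F}(\alpha)$ is nonzero and equals $[\overline{e^T_{\mathcal F}}]$ evaluated at the point of the projective space determined by the class of $\alpha$.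
   Context: $A$ is analytically unramified if its $\mathfrak m$-adic completion is reduced. $\overline{\mathfrak a}$ denotes the integral closure of an ideal $\mathfrak a$. MCM means maximal Cohen-Macaulay. $\mathbb N$ is the set of non-negative integers. For a $k$-vector space $V$, $\mathbb P(V)$ is the projective space of lines (one-dimensional subspaces) in $V$; modules over $A$ are viewed as $k$-vector spaces via $k\subseteq A$. A filtration $\mathcal F=\{F_n\}_{n\in\mathbb Z}$ of ideals of $A$ is $I$-admissible if $I^n\subseteq F_n$ for all $n$, $F_nF_m\subseteq F_{n+m}$ for all $n,m$, and $F_n=IF_{n-1}$ for $n\gg0$. For an MCM $A$-module $M$ set $$e^T_{\mathcal F}(M)=\lim_{n\to\infty}\frac{(d-1)!}{n^{d-1}}\,\ell\bigl(\operatorname{Tor}^A_1(M,A/I_{n+1})\bigr)$$ (a non-negative integer). For $\alpha\in\operatorname{Ext}^1_A(M,N)$ represented by $0\to N\to E\to M\to 0$ (with $M,N$, hence $E$, MCM) set $e^T_{\mathcal F}(\alpha)=e^T_{\mathcal F}(M)+e^T_{\mathcal F}(N)-e^T_{\mathcal F}(E)\ge 0$. The extension $\alpha$ is $T_{\mathcal F}$-split if $e^T_{\mathcal F}(\alpha)=0$, and $T_{\mathcal F}(M,N)\subseteq\operatorname{Ext}^1_A(M,N)$ is the set of $T_{\mathcal F}$-split extensions (a submodule). *)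

(* Defs.v *)
From HB Require Import structures.
From mathcomp Require Import all_boot all_order all_algebra.
From mathcomp Require Import finmap generic_quotient ring_quotient.
From mathcomp Require Import all_classical reals topology normedtype sequences.
Set Implicit Arguments.
Unset Strict Implicit.
Unset Printing Implicit Defensive.
Import Order.TTheory GRing.Theory Num.Theory.
Import numFieldNormedType.Exports.
Local Open Scope classical_set_scope.
Local Open Scope quotient_scope.
Local Open Scope ring_scope.

Section Modules.
Variable R : pzRingType.
Implicit Types V W : lmodType R.

Definition submod V (S : submodClosed V) : Type := {x : V | x \in S}.
HB.instance Definition _ V (S : submodClosed V) :=
  SubChoice.copy (submod S) {x : V | x \in S}.
HB.instance Definition _ V (S : submodClosed V) :=
  [SubChoice_isSubLmodule of submod S by <:].

Lemma submod_val_is_linear V (S : submodClosed V) : linear (val : submod S -> V).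
Proof. by move=> a x y; rewrite linearP. Qed.

(* ring_quotient quotients by a zmodClosed; a submodClosed is not canonically one. *)
Definition zmod_of V (S : submodClosed V) : {pred V} := fun x => x \in S.
HB.instance Definition _ V (S : submodClosed V) :=
  GRing.isZmodClosed.Build V (zmod_of S)
    (GRing.subsemimod_closedB (GRing.subsemimodClosedP S)).

Definition quotmod V (S : submodClosed V) : Type := {ideal_quot (zmod_of S)}.
HB.instance Definition _ V (S : submodClosed V) := GRing.Zmodule.on (quotmod S).

Definition qproj V (S : submodClosed V) (x : V) : quotmod S := \pi_({ideal_quot (zmod_of S)}) x.

Lemma qproj_is_zmod V (S : submodClosed V) : zmod_morphism (@qproj V S).
Proof. by move=> x y; rewrite /qproj raddfB. Qed.

Lemma qproj_surj V (S : submodClosed V) (q : quotmod S) : exists x, qproj S x = q.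
Proof. by exists (repr (q : {ideal_quot (zmod_of S)})); rewrite /qproj reprK. Qed.

Lemma qproj_eq V (S : submodClosed V) x y : (qproj S x == qproj S y) = (x - y \in S).
Proof. by exact: (esym (Quotient.idealrBE (zmod_of S) x y)). Qed.

(* {ideal_quot _} is only a Z-module here: add the scaling. *)
Definition quotscale V (S : submodClosed V) (a : R) (q : quotmod S) : quotmod S :=
  qproj S (a *: repr (q : {ideal_quot (zmod_of S)})).

Lemma qproj_scale V (S : submodClosed V) a x :
  quotscale a (qproj S x) = qproj S (a *: x).
Proof.
apply/eqP; rewrite qproj_eq -scalerBr rpredZ // -qproj_eq.
by rewrite /qproj reprK.
Qed.

Fact quotscaleA V (S : submodClosed V) (a b : R) (q : quotmod S) :
  quotscale a (quotscale b q) = quotscale (a * b) q.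
Proof. by have [x <-] := qproj_surj q; rewrite !qproj_scale scalerA. Qed.

Fact quotscale0r V (S : submodClosed V) (q : quotmod S) : quotscale 0 q = 0.
Proof.
have [x <-] := qproj_surj q; rewrite qproj_scale scale0r.
by rewrite -(subrr x) qproj_is_zmod subrr.
Qed.

Fact quotscale1r V (S : submodClosed V) (q : quotmod S) : quotscale 1 q = q.
Proof. by have [x <-] := qproj_surj q; rewrite qproj_scale scale1r. Qed.

Lemma qprojD V (S : submodClosed V) x y : qproj S (x + y) = qproj S x + qproj S y.
Proof. by rewrite /qproj raddfD. Qed.

Fact quotscaleDr V (S : submodClosed V) (a : R) :
  {morph @quotscale V S a : q r / q + r}.
Proof.
move=> q r; have [x <-] := qproj_surj q; have [y <-] := qproj_surj r.
by rewrite -qprojD !qproj_scale -qprojD scalerDr.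
Qed.

Fact quotscaleDl V (S : submodClosed V) (q : quotmod S) (a b : R) :
  quotscale (a + b) q = quotscale a q + quotscale b q.
Proof.
by have [x <-] := qproj_surj q; rewrite !qproj_scale -qprojD scalerDl.
Qed.

HB.instance Definition _ V (S : submodClosed V) :=
  GRing.Zmodule_isLmodule.Build R (quotmod S) (@quotscaleA V S)
    (@quotscale1r V S) (@quotscaleDr V S) (@quotscaleDl V S).

Fact qproj_is_linear V (S : submodClosed V) : linear (qproj S).
Proof. by move=> a x y; rewrite qprojD -qproj_scale. Qed.
HB.instance Definition _ V (S : submodClosed V) :=
  GRing.isLinear.Build R V (quotmod S) *:%R (qproj S) (@qproj_is_linear V S).

Lemma qproj_eq0 V (S : submodClosed V) x : (qproj S x == 0) = (x \in S).
Proof. by rewrite -(linear0 (qproj S)) qproj_eq subr0. Qed.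

(* The submodule generated by X, as the smallest submodule containing it. *)
Definition gen_submod V (X : set V) : {pred V} := fun x =>
  `[< forall S : submodClosed V, (forall y, X y -> y \in S) -> x \in S >].
Fact gen_submod_closed V (X : set V) : submod_closed (gen_submod X).
Proof.
split=> [|a x y /asboolP hx /asboolP hy]; apply/asboolP => S hS.
  exact: rpred0.
by rewrite rpredD ?rpredZ ?hx ?hy.
Qed.
HB.instance Definition _ V (X : set V) := GRing.isSubmodClosed.Build R V (gen_submod X)
  (GRing.submod_closed_semi (@gen_submod_closed V X)).

Definition ker_mod V W (f : {linear V -> W}) : {pred V} := fun x => f x == 0.
Fact ker_mod_closed V W (f : {linear V -> W}) : submod_closed (ker_mod f).
Proof.
split=> [|a x y]; rewrite !unfold_in /ker_mod ?linear0 // linearP.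
by move=> /eqP-> /eqP->; rewrite scaler0 addr0.
Qed.
HB.instance Definition _ V W (f : {linear V -> W}) :=
  GRing.isSubmodClosed.Build R V (ker_mod f)
    (GRing.submod_closed_semi (ker_mod_closed f)).

Definition im_mod V W (f : {linear V -> W}) : {pred W} := fun y =>
  `[< exists x, f x = y >].
Fact im_mod_closed V W (f : {linear V -> W}) : submod_closed (im_mod f).
Proof.
split=> [|a _ _ /asboolP[x <-] /asboolP[y <-]]; apply/asboolP.
  by exists 0; rewrite linear0.
by exists (a *: x + y); rewrite linearP.
Qed.
HB.instance Definition _ V W (f : {linear V -> W}) :=
  GRing.isSubmodClosed.Build R W (im_mod f)
    (GRing.submod_closed_semi (im_mod_closed f)).

Definition trace_submod V (Z B : submodClosed V) : {pred submod Z} :=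
  fun z => val z \in B.
Arguments trace_submod {V} Z B _.
Fact trace_submod_closed V (Z B : submodClosed V) : submod_closed (trace_submod Z B).
Proof.
split=> [|a x y hx hy]; first exact: (rpred0 B).
by rewrite unfold_in /trace_submod submod_val_is_linear rpredD ?rpredZ.
Qed.
HB.instance Definition _ V (Z B : submodClosed V) :=
  GRing.isSubmodClosed.Build R (submod Z) (trace_submod Z B)
    (GRing.submod_closed_semi (@trace_submod_closed V Z B)).

(* Z / B when B is contained in Z, e.g. cycles modulo boundaries. *)
Definition subquot V (Z B : submodClosed V) : Type := quotmod (trace_submod Z B).
HB.instance Definition _ V (Z B : submodClosed V) :=
  GRing.Lmodule.on (subquot Z B).

Definition full_mod V : {pred V} := fun=> true.
Fact full_mod_closed V : submod_closed (@full_mod V). Proof. by []. Qed.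
HB.instance Definition _ V := GRing.isSubmodClosed.Build R V (@full_mod V)
  (GRing.submod_closed_semi (@full_mod_closed V)).

Definition fin_gen V := exists s : seq V, @full_mod V =i gen_submod [set` s].
End Modules.

Section Homological.
Variable A : comNzRingType.
Implicit Types U V W M N : lmodType A.

(* The free module on X is the module of finitely supported functions X -> A. *)
Definition fin_supp (X : Type) : {pred X -> A^o} := fun f =>
  `[< finite_set [set x | f x != 0] >].
Fact fin_supp_closed X : submod_closed (@fin_supp X).
Proof.
split=> [|a f g /asboolP hf /asboolP hg]; apply/asboolP.
  by apply: (@sub_finite_set _ _ set0) => // x /=; rewrite eqxx.
apply: (@sub_finite_set _ _ ([set x | f x != 0] `|` [set x | g x != 0])).
  move=> x /=; apply: contraNP => /not_orP[/negP/negPn/eqP h1 /negP/negPn/eqP h2].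
  have -> : (a *: f + g) x = a *: f x + g x by [].
  by rewrite h1 h2 scaler0 addr0.
by rewrite finite_setU.
Qed.
HB.instance Definition _ X := GRing.isSubmodClosed.Build A (X -> A^o)
  (@fin_supp X) (GRing.submod_closed_semi (@fin_supp_closed X)).

Definition free_mod (X : Type) : Type := submod (@fin_supp X).
HB.instance Definition _ X := SubChoice.on (free_mod X).
HB.instance Definition _ X := GRing.Lmodule.on (free_mod X).

Definition free_coef X (f : free_mod X) : X -> A := val (f : submod (@fin_supp X)).

Lemma free_coefP X a (f g : free_mod X) x :
  free_coef (a *: f + g) x = a * free_coef f x + free_coef g x.
Proof.
exact: (congr1 (fun h : X -> A^o => h x)
  (@submod_val_is_linear A (X -> A^o) (@fin_supp X) a f g)).
Qed.

Definition free_delta (X : choiceType) (x : X) : X -> A^o := fun y => (x == y)%:R.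
Fact free_delta_fin_supp (X : choiceType) (x : X) : free_delta x \in @fin_supp X.
Proof.
apply/asboolP; apply: (@sub_finite_set _ _ [set x]) => // y /=.
by rewrite /free_delta; have [->|_ /eqP] := eqVneq x y.
Qed.
Definition free_gen (X : choiceType) (x : X) : free_mod X :=
  exist _ (free_delta x) (free_delta_fin_supp x).

Definition free_lift (X : choiceType) V (h : X -> V) (f : free_mod X) : V :=
  \sum_(x \in [set: X]) free_coef f x *: h x.
Fact free_lift_is_linear (X : choiceType) V (h : X -> V) :
  linear (free_lift h).
Proof.
have red (f : free_mod X) (D : set X) : finite_set D ->
    [set x | free_coef f x != 0] `<=` D ->
    free_lift h f = \sum_(x <- fset_set D) free_coef f x *: h x.
  move=> fD sD; rewrite -fsbig_finite // /free_lift.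
  apply/esym/fsbig_widen => // x [_ /= nD].
  have /eqP -> : free_coef f x == 0 by apply: contra_notT nD => /sD.
  by rewrite scale0r.
move=> a f g.
have /asboolP ff := valP f; have /asboolP fg := valP g.
set D := [set x | free_coef f x != 0] `|` [set x | free_coef g x != 0].
have fD : finite_set D by rewrite finite_setU.
rewrite (red f D) // ?(red g D) //; [|by move=> ?; right|by move=> ?; left].
rewrite (red _ D) //; last first.
  move=> x /=; apply: contraNP => /not_orP[/negP/negPn/eqP h1 /negP/negPn/eqP h2].
  by rewrite free_coefP h1 h2 mulr0 addr0.
rewrite scaler_sumr -big_split /=; apply: eq_bigr => x _.
by rewrite free_coefP scalerA -scalerDl.
Qed.
HB.instance Definition _ (X : choiceType) V (h : X -> V) :=
  GRing.isLinear.Build A (free_mod X) V *:%R (free_lift h)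
    (free_lift_is_linear h).

Definition tensor_rel M N : set (free_mod (M * N)%type) :=
  [set z | (exists a m m' n, z = free_gen (a *: m + m', n)
                                 - a *: free_gen (m, n) - free_gen (m', n))
        \/ (exists a m n n', z = free_gen (m, a *: n + n')
                                 - a *: free_gen (m, n) - free_gen (m, n'))].
Definition tensor M N : Type := quotmod (gen_submod (@tensor_rel M N)).
HB.instance Definition _ M N := GRing.Lmodule.on (tensor M N).

Definition tensor_proj M N : free_mod (M * N)%type -> tensor M N :=
  qproj (gen_submod (@tensor_rel M N)).
HB.instance Definition _ M N := GRing.Linear.on (@tensor_proj M N).

Lemma free_lift_gen (X : choiceType) V (h : X -> V) x :
  free_lift h (free_gen x) = h x.
Proof.
rewrite /free_lift /free_gen /free_coef /= (fsbigE [:: x]) //= ?big_seq1.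
- by rewrite big_cons big_nil ifT ?addr0 /free_delta ?eqxx ?scale1r //; exact: mem_set.
- by move=> y _; rewrite inE /free_delta eq_sym => /negPf ->; rewrite scale0r.
Qed.

Section TensorMap.
Variables (M M' N : lmodType A) (f : {linear M -> M'}).

Definition tensor_map_free : free_mod (M * N)%type -> tensor M' N :=
  @tensor_proj M' N \o free_lift (fun p => free_gen (f p.1, p.2)).
HB.instance Definition _ := GRing.Linear.on tensor_map_free.

Lemma tensor_map_free_rel z :
  z \in gen_submod (@tensor_rel M N) -> tensor_map_free z = 0.
Proof.
move=> /asboolP /(_ (ker_mod tensor_map_free)) h; apply/eqP; apply: h => {z}.
have rel0 w : tensor_rel w -> @tensor_proj M' N w = 0.
  move=> hw; apply/eqP; rewrite /tensor_proj qproj_eq0.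
  by apply/asboolP => S; apply.
move=> z hz; apply/eqP; rewrite /tensor_map_free /=.
case: hz => -[a [m [m' [n ->]]]]; apply: rel0; [left|right].
  by exists a, (f m), (f m'), n; rewrite !linearB linearZ /= !free_lift_gen /= linearP.
by exists a, (f m), m', n; rewrite !linearB linearZ /= !free_lift_gen.
Qed.

Definition tensor_map (q : tensor M N) : tensor M' N :=
  tensor_map_free (repr (q : {ideal_quot (zmod_of (gen_submod (@tensor_rel M N)))})).

Lemma tensor_mapE z : tensor_map (tensor_proj z) = tensor_map_free z.
Proof.
apply/eqP; rewrite -subr_eq0 -linearB; apply/eqP/tensor_map_free_rel.
by rewrite -qproj_eq; apply/eqP; rewrite {1}/qproj reprK.
Qed.

Fact tensor_map_is_linear : linear tensor_map.
Proof.
move=> a q r.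
have [x <-] := qproj_surj q; have [y <-] := qproj_surj r.
rewrite -!/(tensor_proj _).
have -> : a *: tensor_proj x + tensor_proj y = tensor_proj (a *: x + y).
  by rewrite linearP.
by rewrite !tensor_mapE linearP.
Qed.
HB.instance Definition _ := GRing.isLinear.Build A (tensor M N) (tensor M' N)
  *:%R tensor_map tensor_map_is_linear.
End TensorMap.

End Homological.

Arguments tensor_map {A M M'} N f q.


Section Resolution.
Variable A : comNzRingType.
Implicit Types U V W M N : lmodType A.

(* The standard free resolution of M: the canonical map augm from the free
   module on the set M onto M has kernel syz M, and one iterates:
     ... -> F(syz (syz M)) -> F(syz M) -> F(M) -> M -> 0
   with differentials res_d (syz M) and res_d M. Tor1 and Ext1 below are the
   first (co)homology of its tensor product with N, resp. of Hom(-, N). *)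
Definition augm M : free_mod A M -> M := free_lift (@id M).
HB.instance Definition _ M := GRing.Linear.on (@augm M).

Definition syz M : Type := submod (ker_mod (@augm M)).
HB.instance Definition _ M := GRing.Lmodule.on (syz M).

Definition syz_val M : syz M -> free_mod A M :=
  (val : submod (ker_mod (@augm M)) -> free_mod A M).
HB.instance Definition _ M := GRing.isLinear.Build A (syz M) (free_mod A M)
  *:%R (@syz_val M) (submod_val_is_linear (S := ker_mod (@augm M))).

Definition res_d M : free_mod A (syz M) -> free_mod A M :=
  @syz_val M \o @augm (syz M).
HB.instance Definition _ M := GRing.Linear.on (@res_d M).

Definition tensor_d M N :
    {linear tensor (free_mod A (syz M)) N -> tensor (free_mod A M) N} :=
  tensor_map N (@res_d M).

Definition Tor1 M N : lmodType A :=
  subquot (ker_mod (tensor_d M N)) (im_mod (tensor_d (syz M) N)).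

Definition linear_pred V W : {pred V -> W} := fun f => `[< linear f >].
Fact linear_pred_closed V W : submod_closed (@linear_pred V W).
Proof.
split=> [|a f g /asboolP hf /asboolP hg]; apply/asboolP => b x y.
  by rewrite scaler0 addr0.
have E z : (a *: f + g) z = a *: f z + g z by [].
rewrite !E hf hg !scalerDr !scalerA (mulrC b).
by rewrite -!addrA; congr (_ + _); rewrite addrCA.
Qed.
HB.instance Definition _ V W := GRing.isSubmodClosed.Build A (V -> W)
  (@linear_pred V W) (GRing.submod_closed_semi (@linear_pred_closed V W)).

Definition hom V W : Type := submod (@linear_pred V W).
HB.instance Definition _ V W := GRing.Lmodule.on (hom V W).
Definition hom_fun V W (f : hom V W) : V -> W :=
  val (f : submod (@linear_pred V W)).

Section Precomp.
Variables (U V W : lmodType A) (f : {linear U -> V}).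
Fact precomp_subproof (g : hom V W) : hom_fun g \o f \in @linear_pred U W.
Proof.
have /asboolP hg := valP (g : submod (@linear_pred V W)).
by apply/asboolP => a x y; rewrite /= linearP; exact: hg.
Qed.
Definition precomp (g : hom V W) : hom U W := 
  exist (fun h => h \in @linear_pred U W) (hom_fun g \o f) (precomp_subproof g).
Fact precomp_is_linear : linear precomp.
Proof. by move=> a g h; apply: val_inj. Qed.
HB.instance Definition _ := GRing.isLinear.Build A (hom V W) (hom U W)
  *:%R precomp precomp_is_linear.
End Precomp.

Definition hom_d M N :
    {linear hom (free_mod A M) N -> hom (free_mod A (syz M)) N} :=
  precomp (@res_d M).

Definition Ext1 M N : lmodType A :=
  subquot (ker_mod (hom_d (syz M) N)) (im_mod (hom_d M N)).

Record extension M N := Extension {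
  ext_mod : lmodType A;
  ext_inj : {linear N -> ext_mod};
  ext_surj : {linear ext_mod -> M};
  _ : injective ext_inj;
  _ : forall x : M, exists e, ext_surj e = x;
  _ : forall e, ext_surj e = 0 <-> exists y, ext_inj y = e
}.

(* The usual dictionary between Ext^1 and extensions: if g lifts the identity
   of M to F(M) -> E, the restriction of g to the image of F(syz M) takes values
   in N, and the 1-cocycle z obtained in this way represents the extension. *)
Definition represents M N (S : extension M N) (alpha : Ext1 M N) : Prop :=
  exists2 z : submod (ker_mod (hom_d (syz M) N)),
    qproj _ z = alpha &
    exists g : {linear free_mod A M -> ext_mod S},
      (forall x, ext_surj S (g x) = augm x) /\
      (forall y, g (res_d y) = ext_inj S (hom_fun (val z) y)).
End Resolution.

Section QuotientRing.
Variables (R : comPzRingType) (J : submodClosed R^o).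

(* {ideal_quot _} has a ring structure for proper ideals only, as an nzRing; here J
   is any ideal and the quotient is a comPzRing. *)
Definition quot_ring : Type := quotmod J.
HB.instance Definition _ := GRing.Zmodule.on quot_ring.

Definition rproj : R -> quot_ring := qproj J.

Lemma rproj_eq (x y : R) : (rproj x == rproj y) = (x - y \in J).
Proof. exact: (@qproj_eq R R^o J x y). Qed.

Lemma rproj_surj (q : quot_ring) : exists x, rproj x = q.
Proof. exact: (@qproj_surj R R^o J q). Qed.

Lemma rprojD (x y : R) : rproj (x + y) = rproj x + rproj y.
Proof. exact: (@qprojD R R^o J x y). Qed.

Definition quot_mul (q r : quot_ring) : quot_ring :=
  rproj ((repr (q : {ideal_quot (zmod_of J)}) : R) *
         (repr (r : {ideal_quot (zmod_of J)}) : R)).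

Lemma rprojM (x y : R) : quot_mul (rproj x) (rproj y) = rproj (x * y).
Proof.
have rep (z : R) : (repr (rproj z : {ideal_quot (zmod_of J)}) : R) - z \in J.
  by rewrite -rproj_eq /rproj /qproj reprK.
apply/eqP; rewrite rproj_eq.
set x' := (X in X * _ - _); set y' := (X in _ * X - _).
have -> : x' * y' - x * y = x' * (y' - y) + y * (x' - x) :> R.
  by rewrite !mulrBr (mulrC y x') (mulrC y x) addrA addrNK.
apply: (@rpredD R^o J).
  exact: (@rpredZ R R^o J x' _ (rep y)).
exact: (@rpredZ R R^o J y _ (rep x)).
Qed.

Fact quot_mulA : associative quot_mul.
Proof.
move=> q r s; have [x <-] := rproj_surj q; have [y <-] := rproj_surj r.
by have [z <-] := rproj_surj s; rewrite !rprojM mulrA.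
Qed.
Fact quot_mulC : commutative quot_mul.
Proof.
move=> q r; have [x <-] := rproj_surj q; have [y <-] := rproj_surj r.
by rewrite !rprojM mulrC.
Qed.
Fact quot_mul1 : left_id (rproj 1) quot_mul.
Proof. by move=> q; have [x <-] := rproj_surj q; rewrite rprojM mul1r. Qed.
Fact quot_mulDl : left_distributive quot_mul +%R.
Proof.
move=> q r s; have [x <-] := rproj_surj q; have [y <-] := rproj_surj r.
by have [z <-] := rproj_surj s; rewrite -rprojD !rprojM -rprojD mulrDl.
Qed.
HB.instance Definition _ := GRing.Zmodule_isComPzRing.Build quot_ring
  quot_mulA quot_mulC quot_mul1 quot_mulDl.
End QuotientRing.

Section Ideals.
Variable R : comPzRingType.
Implicit Types (I J K m : submodClosed R^o) (M : lmodType R).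

(* J S; ideals being submodules of R^o, this is also the product of ideals. *)
Definition smul J M (S : submodClosed M) : submodClosed M :=
  gen_submod [set z | exists a x, [/\ a \in J, x \in S & z = (a : R) *: x]].

Fixpoint ideal_pow I n : submodClosed R^o :=
  if n is k.+1 then smul I (ideal_pow I k) else @full_mod R R^o.

Definition ideal_powz I (n : int) : submodClosed R^o :=
  if n is Posz k then ideal_pow I k else @full_mod R R^o.

Definition is_reduced := forall (x : R) n, x ^+ n = 0 -> x = 0.

(* x^n + a_1 x^(n-1) + ... + a_n = 0 with n > 0 and a_i in I^i. *)
Definition integral_closure I : set R := [set x |
  exists2 a : nat -> R, a 0 = 1 & exists2 n : nat, (0 < n)%N &
    (forall i, (a i : R^o) \in ideal_pow I i) /\
    \sum_(i < n.+1) a i * x ^+ (n - i) = 0].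

Definition proper_id J := (1 : R^o) \notin J.

Definition prime_id J := proper_id J /\
  forall x y : R, (x * y : R^o) \in J -> (x : R^o) \in J \/ (y : R^o) \in J.

Definition maximal_id J := proper_id J /\
  forall K, {subset J <= K} -> proper_id K -> K =i J.

Definition radical J : set R := [set x | exists n, (x ^+ n : R^o) \in J].

Definition primary_id J := proper_id J /\
  forall x y : R, (x * y : R^o) \in J -> (x : R^o) \in J \/ radical J y.

Definition primary_to m J := primary_id J /\ radical J = [set` m].

Definition noetherian := forall J, exists s : seq R^o, J =i gen_submod [set` s].

Definition noetherian_local m :=
  [/\ noetherian, maximal_id m & forall m', maximal_id m' -> m' =i m].

End Ideals.

Section Completion.
Variables (R : comPzRingType) (m : submodClosed R^o).

Lemma ideal_powM n (a x : R) :
  (x : R^o) \in ideal_pow m n -> (a * x : R^o) \in ideal_pow m n.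
Proof. exact: (@rpredZ R R^o (ideal_pow m n) a). Qed.

(* The inverse limit of the R / m^n, in terms of representatives: sequences x with
   x_(n+1) = x_n mod m^n, modulo those with x_n in m^n for all n. *)
Definition coherent : {pred nat -> R} := fun x =>
  `[< forall n, (x n.+1 - x n : R^o) \in ideal_pow m n >].
Fact coherent_closed : subring_closed coherent.
Proof.
split=> [|x y /asboolP hx /asboolP hy|x y /asboolP hx /asboolP hy];
  apply/asboolP => n.
- by rewrite [X in X \in _](subrr (1 : R)) rpred0.
- have -> : (x - y) n.+1 - (x - y) n = (x n.+1 - x n) - (y n.+1 - y n).
    by rewrite !opprD !opprK addrACA.
  exact: (GRing.subsemimod_closedB
    (GRing.subsemimodClosedP (ideal_pow m n))).2.
have -> : (x * y) n.+1 - (x * y) n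
    = y n.+1 * (x n.+1 - x n) + x n * (y n.+1 - y n).
  by rewrite !mulrBr (mulrC _ (x n.+1)) (mulrC _ (x n)) addrA addrNK.
by apply: (@rpredD R^o); apply: ideal_powM.
Qed.
HB.instance Definition _ := GRing.isSubringClosed.Build (nat -> R) coherent
  coherent_closed.

Definition coherent_seq : Type := {x : nat -> R | x \in coherent}.
HB.instance Definition _ :=
  SubChoice.copy coherent_seq {x : nat -> R | x \in coherent}.
HB.instance Definition _ := GRing.SubChoice_isSubComPzRing.Build (nat -> R)
  coherent coherent_seq (GRing.subringClosedP _).

Definition coherent_null : {pred coherent_seq^o} := fun x =>
  `[< forall n, (val (x : coherent_seq) n : R^o) \in ideal_pow m n >].
Fact coherent_null_closed : submod_closed coherent_null.
Proof.
split=> [|a x y /asboolP hx /asboolP hy]; apply/asboolP => n.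
  exact: (@rpred0 R^o (ideal_pow m n)).
by apply: (@rpredD R^o); [apply: ideal_powM|].
Qed.
HB.instance Definition _ := GRing.isSubmodClosed.Build coherent_seq
  coherent_seq^o coherent_null (GRing.submod_closed_semi coherent_null_closed).

Definition adic_completion : comPzRingType :=
  @quot_ring coherent_seq coherent_null.
End Completion.

Section Invariants.

Definition strict_chain T (P : set (set T)) n :=
  exists c : nat -> set T, (forall i, (i <= n)%N -> P (c i)) /\
                           (forall i, (i < n)%N -> c i `<` c i.+1).

(* n is the largest length of a chain in P; no such n exists if the lengths are
   unbounded. *)
Definition max_chain T (P : set (set T)) n :=
  strict_chain P n /\ forall k, strict_chain P k -> (k <= n)%N.

Definition krull_dim (R : comPzRingType) (d : nat) :=
  max_chain [set p | exists2 J : submodClosed R^o, prime_id J & p = [set` J]] d.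

Definition has_length (R : pzRingType) (V : lmodType R) n :=
  max_chain [set p | exists S : submodClosed V, p = [set` S]] n.

(* Conventionally 0 for a module of infinite length. *)
Definition mod_length (R : pzRingType) (V : lmodType R) : nat :=
  xget 0%N [set n | has_length V n].

(* The last condition is (s) M <> M. In particular [::] is regular on M iff M is
   nonzero, so that the zero module has no depth. *)
Definition regular_seq (R : comPzRingType) (M : lmodType R) (s : seq R) :=
  let Q i : submodClosed M := smul (gen_submod [set` take i s : seq R^o])
                                   (@full_mod R M) in
  (forall i, (i < size s)%N -> forall x : M, s`_i *: x \in Q i -> x \in Q i)
  /\ exists x : M, x \notin Q (size s).

Definition has_depth (R : comPzRingType) (m : submodClosed R^o)
    (M : lmodType R) (n : nat) :=
  (exists2 s : seq R, {subset (s : seq R^o) <= m} /\ size s = n & regular_seq M s)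
  /\ forall s : seq R, {subset (s : seq R^o) <= m} -> regular_seq M s ->
       (size s <= n)%N.

Definition max_cohen_macaulay (R : comPzRingType) (m : submodClosed R^o)
    (M : lmodType R) :=
  fin_gen M /\ exists2 d, krull_dim R d & has_depth m M d.

Definition cohen_macaulay (R : comPzRingType) (m : submodClosed R^o) :=
  max_cohen_macaulay m R^o.

(* To be used on (quotients that are) fields: characteristic 0, or surjective
   Frobenius. *)
Definition perfect (K : comPzRingType) :=
  forall p, prime p -> p%:R = 0 :> K -> forall x : K, exists y, x = y ^+ p.
End Invariants.

Section Filtrations.
Variable A : comNzRingType.
Implicit Types (I : submodClosed A^o) (F : int -> submodClosed A^o).

(* As I^n = A for n <= 0, the first two conditions give F n <= F (n - 1). *)
Definition admissible I F :=
  [/\ forall n, {subset ideal_powz I n <= F n},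
      forall n k (x y : A), (x : A^o) \in F n -> (y : A^o) \in F k ->
        (x * y : A^o) \in F (n + k)
    & exists n0 : int, forall n, n0 <= n -> F n =i smul I (F (n - 1))].

Definition eT (R : realType) F d (M : lmodType A) : R :=
  lim ((fun n : nat => (d.-1)`!%:R / n%:R ^+ d.-1
    * (mod_length (Tor1 M (quotmod (F n.+1%:Z))))%:R : R) @ \oo).

(* The middle terms of the extensions representing alpha are isomorphic, so the
   value v does not depend on the choice of S. *)
Definition eT_ext (R : realType) F d (M N : lmodType A) (alpha : Ext1 M N) : R :=
  xget 0 [set v | exists2 S : extension M N, represents S alpha &
    v = eT R F d M + eT R F d N - eT R F d (ext_mod S)].

Definition T_split (R : realType) F d (M N : lmodType A) : set (Ext1 M N) :=
  [set alpha | eT_ext R F d alpha = 0].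
End Filtrations.
Arguments T_split {A} R F d M N.

(* V seen as a K-vector space along iota. *)
Definition restr_scal (K A : pzRingType) (iota : {rmorphism K -> A})
  (V : lmodType A) : Type := V.

Section RestrictScalars.
Variables (K A : pzRingType) (iota : {rmorphism K -> A}) (V : lmodType A).
Local Notation RV := (restr_scal iota V).
HB.instance Definition _ := GRing.Zmodule.on RV.

Definition restr_scale (c : K) (v : RV) : RV := iota c *: (v : V).
Fact restr_scaleA c e v : restr_scale c (restr_scale e v) = restr_scale (c * e) v.
Proof. by rewrite /restr_scale rmorphM scalerA. Qed.
Fact restr_scale1 : left_id 1 restr_scale.
Proof. by move=> v; rewrite /restr_scale rmorph1 scale1r. Qed.
Fact restr_scaleDr : right_distributive restr_scale +%R.
Proof. by move=> c v w; rewrite /restr_scale scalerDr. Qed.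
Fact restr_scaleDl v : {morph restr_scale^~ v : c e / c + e}.
Proof. by move=> c e; rewrite /restr_scale rmorphD scalerDl. Qed.
HB.instance Definition _ := GRing.Zmodule_isLmodule.Build K RV
  restr_scaleA restr_scale1 restr_scaleDr restr_scaleDl.
End RestrictScalars.

Definition proj_space (K : fieldType) (V : lmodType K) : Type :=
  {L : set V | exists2 v, v != 0 & L = [set c *: v | c in [set: K]]}.

Definition proj_pt (K : fieldType) (V : lmodType K) (v : V) (v0 : v != 0) :
    proj_space V :=
  exist _ [set c *: v | c in [set: K]] (ex_intro2 _ _ v v0 erefl).

Lemma qproj_neq0 (R : pzRingType) (V : lmodType R) (S : submodClosed V) (x : V) :
  x \notin S -> qproj S x != 0.
Proof. by rewrite qproj_eq0. Qed.

(* The point of P(V / S) defined by the class of an x outside S. *)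
Definition proj_class (K : fieldType) (A : comNzRingType)
    (iota : {rmorphism K -> A}) (V : lmodType A) (S : submodClosed V) (x : V)
    (Sx : x \notin S) : proj_space (restr_scal iota (quotmod S)) :=
  @proj_pt K (restr_scal iota (quotmod S)) (qproj S x) (qproj_neq0 Sx).

(* Main.v *)
(* Both e^T and the submodule T are controlled by the connecting maps of an extension
   0 -> N -> E -> M -> 0 with cocycle z: for every ideal J, the length of Tor_1(M, A/J)
   plus that of Tor_1(N, A/J) minus that of Tor_1(E, A/J) is the sum of the lengths of
   the images of Tor_1(M, A/J) -> N/JN and Tor_2(M, A/J) -> Tor_1(N, A/J). These images
   vanish on coboundaries, and the one for a z + z' lies in the sum of those for z and
   z'. Hence e^T(a alpha + beta) <= e^T(alpha) + e^T(beta), so that the zero set of e^T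
   is a submodule, on whose cosets e^T is constant, and e^T(c alpha) = e^T(alpha) for a
   unit c.
   The limits defining e^T are integers: the lengths of Tor_1(V, A/F_(n+1)) are
   eventually polynomial in n by the Hilbert-Serre theorem, and of degree < d, since
   Artin-Rees bounds them by lengths of quotients I^(n - c) K / I^(n + 1) K, which are
   compared with those of an ideal of I generated by d parameters. *)
From HB Require Import structures.
Require Import Defs.
From mathcomp Require Import all_boot all_order all_algebra.
From mathcomp Require Import finmap generic_quotient ring_quotient.
From mathcomp Require Import all_classical reals topology normedtype sequences.
From mathcomp Require Import zify ring.
Set Implicit Arguments.
Unset Strict Implicit.
Unset Printing Implicit Defensive.
Import Order.TTheory GRing.Theory Num.Theory.
Import numFieldNormedType.Exports.
Local Open Scope classical_set_scope.
Local Open Scope ring_scope.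

(** * Submodules and lengths *)

(* [Tor1] is built from the free module on all elements of a module, which is in general not
   noetherian, so no Hilbert-Serre argument applies to it directly. Growth is studied instead on a
   presentation by a finite power P of [A], with kernel K, where Tor_1(V, A/J) is (K \cap J P) / J
   K; the lengths are carried back by comparing two projective presentations. The middle term of an
   extension is presented by F(N) x F(M), with a kernel written down from the cocycle. The long
   exact sequence then becomes a count of lengths inside these free modules, and Tor_2 is never
   formed. Lengths, limits and [eT_ext] have default values, hence finiteness, convergence and the
   existence of an extension precede every use of them. The Cohen-Macaulay hypothesis enters through
   a regular sequence of length d: powers of its members lie in I and generate an ideal with radical
   m, which caps the degree at d - 1. *)
Reserved Notation "S <<= T" (at level 70, no associativity).

Section Submodules.
Variable A : comNzRingType.
Implicit Types U V W : lmodType A.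

Definition is_smod V (S : V -> Prop) :=
  S 0 /\ forall a x y, S x -> S y -> S (a *: x + y).

(** A [Prop]-valued counterpart of [submodClosed]: by [smod_ext] mutual inclusion is equality, so
    identities between submodules can be used for rewriting. *)
Record smod V := Smod { smod_pred :> V -> Prop; smodP : is_smod smod_pred }.

Definition sle V (S T : smod V) := forall x, S x -> T x.
Notation "S <<= T" := (sle S T).

Lemma sle_refl V (S : smod V) : S <<= S. Proof. by []. Qed.
Hint Resolve sle_refl : core.

Lemma sle_trans V (T S U : smod V) : S <<= T -> T <<= U -> S <<= U.
Proof. by move=> ST TU x /ST /TU. Qed.

Lemma smod_ext V (S T : smod V) : S <<= T -> T <<= S -> S = T.
Proof.
case: S T => S hS [T hT] ST TS; have E : S = T.
  by apply/funext => x; apply/propext; split; [apply: ST|apply: TS].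
by move: hS hT {ST TS}; rewrite E => hS hT; rewrite (Prop_irrelevance hS hT).
Qed.

Section Closure.
Variables (V : lmodType A) (S : smod V).

Lemma smod0 : S 0. Proof. by case: S => ? []. Qed.

Lemma smodL a x y : S x -> S y -> S (a *: x + y).
Proof. by case: S => ? [? h] /=; apply: h. Qed.

Lemma smodD x y : S x -> S y -> S (x + y).
Proof. by move=> hx hy; rewrite -[x]scale1r; apply: smodL. Qed.

Lemma smodZ a x : S x -> S (a *: x).
Proof. by move=> hx; rewrite -[_ *: _]addr0; apply: smodL => //; exact: smod0. Qed.

Lemma smodN x : S x -> S (- x).
Proof. by rewrite -scaleN1r; apply: smodZ. Qed.

Lemma smodB x y : S x -> S y -> S (x - y).
Proof. by move=> hx hy; apply/smodD/smodN. Qed.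

Lemma smodBD x y : S (x - y) -> S y -> S x.
Proof. by move=> h hy; rewrite -[x](subrK y); apply: smodD. Qed.

End Closure.

Fact zero_is_smod V : is_smod (fun x : V => x = 0).
Proof. by split=> // a x y -> ->; rewrite scaler0 addr0. Qed.
Definition szero V := Smod (zero_is_smod V).

Fact full_is_smod V : is_smod (fun x : V => True).
Proof. by []. Qed.
Definition sfull V := Smod (full_is_smod V).

Fact cap_is_smod V (S T : smod V) : is_smod (fun x => S x /\ T x).
Proof.
split=> [|a x y [? ?] [? ?]]; first by split; exact: smod0.
by split; apply: smodL.
Qed.
Definition scap V (S T : smod V) := Smod (cap_is_smod S T).

Fact add_is_smod V (S T : smod V) :
  is_smod (fun x => exists s t, [/\ S s, T t & x = s + t]).
Proof.
split=> [|a _ _ [s [t [hs ht ->]]] [s' [t' [hs' ht' ->]]]].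
  by exists 0, 0; rewrite addr0; split=> //; exact: smod0.
exists (a *: s + s'), (a *: t + t').
by split; [exact: smodL|exact: smodL|rewrite scalerDr addrACA].
Qed.
Definition sadd V (S T : smod V) := Smod (add_is_smod S T).

Lemma linear_0 V W (f : V -> W) : linear f -> f 0 = 0.
Proof. by move=> hf; move: (hf (-1) 0 0); rewrite !scaleN1r !addNr. Qed.

Lemma linear_Z V W (f : V -> W) a x : linear f -> f (a *: x) = a *: f x.
Proof. by move=> hf; rewrite -[LHS](congr1 f (addr0 _)) hf (linear_0 hf) addr0. Qed.

Lemma linear_B V W (f : V -> W) x y : linear f -> f (x - y) = f x - f y.
Proof. by move=> hf; rewrite -[x - y]addrC -scaleN1r hf scaleN1r addrC. Qed.

Lemma linear_N V W (f : V -> W) x : linear f -> f (- x) = - f x.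
Proof. by move=> hf; rewrite -!scaleN1r linear_Z. Qed.

Lemma linear_D V W (f : V -> W) x y : linear f -> f (x + y) = f x + f y.
Proof. by move=> hf; rewrite -[x]scale1r hf !scale1r. Qed.

Fact img_is_smod V W (f : V -> W) (hf : linear f) (S : smod V) :
  is_smod (fun y => exists2 x, S x & y = f x).
Proof.
split=> [|a _ _ [x hx ->] [x' hx' ->]].
  by exists 0; [exact: smod0|rewrite (linear_0 hf)].
by exists (a *: x + x'); [exact: smodL|rewrite hf].
Qed.
Definition simg V W (f : V -> W) (hf : linear f) S := Smod (img_is_smod hf S).

Fact pre_is_smod V W (f : V -> W) (hf : linear f) (T : smod W) :
  is_smod (fun x => T (f x)).
Proof.
split=> [|a x y hx hy]; first by rewrite (linear_0 hf); exact: smod0.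
by rewrite hf; apply: smodL.
Qed.
Definition spre V W (f : V -> W) (hf : linear f) T := Smod (pre_is_smod hf T).

Fact hull_is_smod V (X : V -> Prop) :
  is_smod (fun x => forall S : smod V, (forall y, X y -> S y) -> S x).
Proof.
split=> [S _|a x y hx hy S hS]; first exact: smod0.
by apply: smodL; [apply: hx|apply: hy].
Qed.
Definition shull V (X : V -> Prop) := Smod (hull_is_smod X).

Lemma shull_mem V (X : V -> Prop) x : X x -> shull X x.
Proof. by move=> hx S; apply. Qed.

Lemma shull_le V (X : V -> Prop) (S : smod V) :
  (forall y, X y -> S y) -> shull X <<= S.
Proof. by move=> h x; apply. Qed.

Definition sspan V (s : seq V) := shull (fun x => x \in s).

Definition smulm V (J : smod A^o) (S : smod V) : smod V :=
  shull (fun z => exists a x, [/\ J a, S x & z = (a : A) *: x]).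


Lemma smulm_mem V (J : smod A^o) (S : smod V) (a : A) x :
  J a -> S x -> smulm J S (a *: x).
Proof. by move=> ha hx; apply: shull_mem; exists a, x. Qed.

Lemma smulm_le V (J : smod A^o) (S T : smod V) :
  (forall (a : A) x, J a -> S x -> T (a *: x)) -> smulm J S <<= T.
Proof. by move=> h; apply: shull_le => _ [a [x [ha hx ->]]]; apply: h. Qed.

Lemma smulm_mono V (J J' : smod A^o) (S S' : smod V) :
  J <<= J' -> S <<= S' -> smulm J S <<= smulm J' S'.
Proof. by move=> hJ hS; apply: smulm_le => a x /hJ ha /hS; apply: smulm_mem. Qed.

Lemma smulm_sub V (J : smod A^o) (S : smod V) : smulm J S <<= S.
Proof. by apply: smulm_le => a x _; apply: smodZ. Qed.

Lemma sadd_l V (S T : smod V) : S <<= sadd S T.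
Proof. by move=> x hx; exists x, 0; rewrite addr0; split=> //; exact: smod0. Qed.

Lemma sadd_r V (S T : smod V) : T <<= sadd S T.
Proof. by move=> x hx; exists 0, x; rewrite add0r; split=> //; exact: smod0. Qed.

Lemma sadd_le V (S T U : smod V) : S <<= U -> T <<= U -> sadd S T <<= U.
Proof. by move=> hS hT _ [s [t [/hS hs /hT ht ->]]]; apply: smodD. Qed.

Lemma smulm_img V W (f : V -> W) (hf : linear f) (J : smod A^o) (S : smod V) x :
  smulm J S x -> smulm J (simg hf S) (f x).
Proof.
move: x; apply: (smulm_le (T := spre hf (smulm J (simg hf S)))) => a x ha hx.
have : smulm J (simg hf S) (a *: f x) by apply: smulm_mem => //; exists x.
by rewrite -(linear_Z _ _ hf).
Qed.

Lemma simg_smulm V W (f : V -> W) (hf : linear f) (J : smod A^o) (S : smod V) :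
  simg hf (smulm J S) = smulm J (simg hf S).
Proof.
apply: smod_ext => [_ [x hx ->]|]; first exact: smulm_img.
apply: smulm_le => a _ ha [x hx ->]; exists (a *: x); first exact: smulm_mem.
by rewrite (linear_Z _ _ hf).
Qed.

Lemma scale_linear V (a : A) : linear (fun x : V => a *: x).
Proof. by move=> b x y; rewrite scalerDr !scalerA mulrC. Qed.

End Submodules.
Notation "S <<= T" := (sle S T).
Arguments smulm_img {A V W f} hf {J S x}.
#[global] Hint Resolve sle_refl : core.

Section Length.
Variable A : comNzRingType.
Implicit Types V W : lmodType A.

(** Chains between [B] and [Z] measure the length of Z/B without forming the quotient. The ends of
    the chain need not be [B] and [Z]. *)
Definition chain V (B Z : smod V) n := exists c : nat -> smod V,
  (forall i, (i <= n)%N -> B <<= c i /\ c i <<= Z) /\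
  (forall i, (i < n)%N -> c i <<= c i.+1 /\ ~ c i.+1 <<= c i).

Definition fin V (B Z : smod V) :=
  B <<= Z /\ exists n, forall k, chain B Z k -> (k <= n)%N.

Definition len V (B Z : smod V) : nat :=
  xget 0%N [set n | chain B Z n /\ forall k, chain B Z k -> (k <= n)%N].

Lemma chain0 V (B Z : smod V) : B <<= Z -> chain B Z 0.
Proof. by move=> h; exists (fun=> B). Qed.

Lemma chain_le V (B Z : smod V) n : chain B Z n -> B <<= Z.
Proof. by case=> c [/(_ 0%N isT) [h1 h2] _] x /h1 /h2. Qed.

Lemma len_eq V (B Z : smod V) n :
  chain B Z n -> (forall k, chain B Z k -> (k <= n)%N) -> len B Z = n.
Proof.
move=> h1 h2; rewrite /len; case: xgetP => [k -> [c1 c2]|/(_ n)].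
  by apply/eqP; rewrite eqn_leq h2 // c2.
by case.
Qed.

Lemma lenP V (B Z : smod V) : fin B Z ->
  chain B Z (len B Z) /\ forall k, chain B Z k -> (k <= len B Z)%N.
Proof.
case=> BZ [n hn].
pose P k := `[< chain B Z k >].
have exP : exists k, P k by exists 0%N; apply/asboolP/chain0.
have bdP k : P k -> (k <= n)%N by move/asboolP/hn.
case: (ex_maxnP exP bdP) => k /asboolP ck mk.
have mk' j : chain B Z j -> (j <= k)%N by move=> /asboolP; apply: mk.
by rewrite (len_eq ck mk').
Qed.

(** A monotone map that reflects inclusions on the interval from [B] to [Z] keeps strict steps
    strict. *)
Lemma chain_map V W (B Z : smod V) (B' Z' : smod W) (phi : smod V -> smod W) n :
  (forall S, B <<= S -> S <<= Z -> B' <<= phi S /\ phi S <<= Z') ->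
  (forall S T, S <<= T -> phi S <<= phi T) ->
  (forall S T, B <<= S -> S <<= Z -> B <<= T -> T <<= Z ->
     phi T <<= phi S -> T <<= S) ->
  chain B Z n -> chain B' Z' n.
Proof.
move=> h1 h2 h3 [c [cb cs]]; exists (phi \o c); split=> i hi /=.
  by have [? ?] := cb i hi; apply: h1.
have [l nl] := cs i hi; split; first exact: h2.
have [? ?] := cb i (ltnW hi); have [? ?] := cb i.+1 hi.
by move=> h; apply: nl; apply: h3.
Qed.

Lemma len_transfer V W (B Z : smod V) (B' Z' : smod W) :
  B <<= Z -> (forall n, chain B Z n -> chain B' Z' n) -> fin B' Z' ->
  fin B Z /\ (len B Z <= len B' Z')%N.
Proof.
move=> BZ h f'; have f : fin B Z.
  by split=> //; case: f' => _ [n hn]; exists n => k /h /hn.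
by split=> //; apply: (lenP f').2; apply: h; exact: (lenP f).1.
Qed.

Section Transfer.
Variables (V W : lmodType A) (f : V -> W) (hf : linear f).
Variables (B Z : smod V) (B' Z' : smod W).

(** As [f] need not carry [B] into B', Z/B is here a quotient of a submodule of Z'/B'. Chains are
    transported by S |-> f(S) + B'. *)
Lemma len_inj : B <<= Z -> B' <<= Z' -> (forall x, Z x -> Z' (f x)) ->
  (forall x, Z x -> B' (f x) -> B x) -> fin B' Z' ->
  fin B Z /\ (len B Z <= len B' Z')%N.
Proof.
move=> BZ BZ' fZ fB; apply: len_transfer => // n.
apply: (chain_map (phi := fun S => sadd (simg hf S) B')).
- move=> S _ SZ; split; first exact: sadd_r.
  by apply: sadd_le => // _ [x /SZ hx ->]; apply: fZ.
- move=> S T ST; apply: sadd_le; last exact: sadd_r.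
  by move=> _ [x /ST hx ->]; apply: sadd_l; exists x.
- move=> S T BS SZ BT TZ h x Tx.
  have [_ [b [[y Sy ->] hb e]]] : sadd (simg hf S) B' (f x).
    by apply: h; apply: sadd_l; exists x.
  apply: (@smodBD _ _ S x y) => //; apply: BS; apply: fB.
    by apply: smodB; [apply: TZ|apply: SZ].
  by rewrite (linear_B _ _ hf) e addrC addKr.
Qed.

(** Dually, [f] need not carry [Z] into Z': it is enough that Z'/B' is a quotient of a submodule of
    Z/B. Chains are pulled back. *)
Lemma len_surj : B <<= Z -> B' <<= Z' -> (forall x, B x -> B' (f x)) ->
  (forall y, Z' y -> exists2 x, Z x & B' (y - f x)) -> fin B Z ->
  fin B' Z' /\ (len B' Z' <= len B Z)%N.
Proof.
move=> BZ BZ' fB fZ; apply: len_transfer => // n.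
apply: (chain_map (phi := fun S => scap Z (spre hf S))).
- move=> S BS _; split=> [x hx|x []] //.
  by split; [apply: BZ|apply: BS; apply: fB].
- by move=> S T ST x [? ?]; split=> //; apply: ST.
- move=> S T BS SZ BT TZ h y Ty.
  have [x Zx hb] := fZ y (TZ _ Ty).
  apply: (@smodBD _ _ S y (f x)); first exact: BS.
  have [] // : scap Z (spre hf S) x.
  apply: h; split=> //=.
  have -> : f x = y - (y - f x) by rewrite subKr.
  by apply: smodB => //; apply: BT.
Qed.

Lemma len_iso : B <<= Z -> B' <<= Z' ->
  (forall x, Z x -> B x <-> B' (f x)) -> (forall x, Z x -> Z' (f x)) ->
  (forall y, Z' y -> exists2 x, Z x & B' (y - f x)) -> fin B Z \/ fin B' Z' ->
  [/\ fin B Z, fin B' Z' & len B Z = len B' Z'].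
Proof.
move=> BZ BZ' hB fZ sZ h.
have fB x : B x -> B' (f x) by move=> Bx; apply/hB => //; apply: BZ.
have Bf x : Z x -> B' (f x) -> B x by move=> Zx /hB; apply.
have hf1 : fin B Z by case: h => // /(len_inj BZ BZ' fZ Bf) [].
have [hf2 l2] := len_surj BZ BZ' fB sZ hf1.
have [_ l1] := len_inj BZ BZ' fZ Bf hf2.
by split=> //; apply/eqP; rewrite eqn_leq l1 l2.
Qed.

End Transfer.

Lemma id_linear V : linear (fun x : V => x). Proof. by []. Qed.

Lemma chain_mono V (B B' Z Z' : smod V) n :
  B' <<= B -> Z <<= Z' -> chain B Z n -> chain B' Z' n.
Proof.
move=> hB hZ [c [c1 c2]]; exists c; split=> // i /c1 [? ?].
by split; [apply: sle_trans hB _|apply: sle_trans hZ].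
Qed.

Lemma fin_mono V (B B' Z Z' : smod V) :
  B' <<= B -> B <<= Z -> Z <<= Z' -> fin B' Z' ->
  fin B Z /\ (len B Z <= len B' Z')%N.
Proof.
move=> hB BZ hZ; apply: len_transfer => // n; exact: chain_mono.
Qed.

Lemma fin_sub V (B B' Z Z' : smod V) :
  B' <<= B -> B <<= Z -> Z <<= Z' -> fin B' Z' -> fin B Z.
Proof. by move=> h1 h2 h3 /(fin_mono h1 h2 h3) []. Qed.

Lemma chain_ext V (B Z Z' : smod V) n :
  Z <<= Z' -> ~ Z' <<= Z -> chain B Z n -> chain B Z' n.+1.
Proof.
move=> ZZ nZ h; have BZ := chain_le h; case: h => c [c1 c2].
exists (fun i => if (i <= n)%N then c i else Z'); split=> i.
  case: ifP => [/c1 [h1 h2] _|_ _]; split=> //; first exact: sle_trans ZZ.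
  exact: sle_trans ZZ.
rewrite ltnS => hi; rewrite hi; case: ltnP => [/c2//|_].
have [h1 h2] := c1 _ hi; split; first exact: sle_trans ZZ.
by move=> h; apply: nZ; apply: sle_trans h2.
Qed.

Lemma incr_le V (c : nat -> smod V) k : (forall i, (i < k)%N -> c i <<= c i.+1) ->
  forall i, (i <= k)%N -> c i <<= c k.
Proof.
elim: k => [|k IH] h i; first by rewrite leqn0 => /eqP ->.
rewrite leq_eqVlt => /orP[/eqP->//|hi]; apply: sle_trans (h k (ltnSn k)).
by apply: IH => // j hj; apply/h/leqW.
Qed.

Lemma chain_cat V (B C Z : smod V) n k :
  chain B C n -> chain C Z k -> chain B Z (n + k).
Proof.
move=> h; elim: k Z => [|k IH] Z.
  by move=> /chain_le CZ; rewrite addn0; apply: chain_mono h.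
case=> c [c1 c2]; rewrite addnS.
have [l nl] := c2 k (ltnSn k); have [_ cZ] := c1 k.+1 (leqnn _).
apply: chain_mono cZ _ => //; apply: chain_ext l nl _; apply: IH.
exists c; split=> i hi; last by apply: c2; apply: ltnW.
split; first by have [] := c1 i (leqW hi).
apply: incr_le hi => j hj; by have [] := c2 j (leqW hj).
Qed.

(** By the modular law, if neither C \cap c_i nor C + c_i grows from i to i + 1, then c_i does not
    grow either. Each strict step thus survives in one of the two chains. *)
Lemma chain_split V (B C Z : smod V) n : B <<= C -> C <<= Z ->
  chain B Z n -> exists a b, [/\ (n <= a + b)%N, chain B C a & chain C Z b].
Proof.
move=> BC CZ [c [c1 c2]].
suff [a [b [h1 h2 h3]]] : exists a b, [/\ (n <= a + b)%N,
    chain B (scap C (c n)) a & chain C (sadd C (c n)) b].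
  exists a, b; split=> //; first by apply: chain_mono h2 => // x [].
  by apply: chain_mono h3 => //; apply: sadd_le => //; have [] := c1 n (leqnn n).
elim: n c1 c2 => [|n IH] c1 c2.
  exists 0%N, 0%N; split=> //; apply: chain0; last exact: sadd_l.
  by move=> x Bx; split; [apply: BC|have [h _] := c1 0%N isT; apply: h].
have [|i hi|a [b [h1 h2 h3]]] := IH.
- by move=> i hi; apply/c1/ltnW.
- by apply/c2/ltnW.
have [l nl] := c2 n (ltnSn n).
have lI : scap C (c n) <<= scap C (c n.+1) by move=> x [? ?]; split=> //; apply: l.
have lS : sadd C (c n) <<= sadd C (c n.+1).
  by apply: sadd_le; [exact: sadd_l|apply: sle_trans l _; exact: sadd_r].
have [hI|nI] := pselect (scap C (c n.+1) <<= scap C (c n)); last first.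
  exists a.+1, b; split=> //; first exact: chain_ext nI h2.
  exact: chain_mono lS h3.
exists a, b.+1; split; first by rewrite addnS ltnS.
  exact: chain_mono lI h2.
apply: chain_ext lS _ h3 => hS; apply: nl => x hx.
have [s [t [Cs ct e]]] := hS x (sadd_r C hx).
have sE : s = x - t by rewrite e addrK.
rewrite e; apply: smodD => //.
have [] // : scap C (c n) s; apply: hI; split=> //.
by rewrite sE; apply: smodB => //; apply: l.
Qed.

Lemma len_add V (B C Z : smod V) : fin B C -> fin C Z ->
  fin B Z /\ len B Z = (len B C + len C Z)%N.
Proof.
move=> f1 f2; have [c1 m1] := lenP f1; have [c2 m2] := lenP f2.
have BC := chain_le c1; have CZ := chain_le c2.
have m n : chain B Z n -> (n <= len B C + len C Z)%N.
  move=> /(chain_split BC CZ) [a [b [h /m1 ha /m2 hb]]].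
  by apply: leq_trans h _; apply: leq_add.
have c := chain_cat c1 c2; split; last exact: len_eq.
by split; [exact: sle_trans CZ|exists (len B C + len C Z)%N].
Qed.

Lemma fin_trans V (C B Z : smod V) : fin B C -> fin C Z -> fin B Z.
Proof. by move=> f /(len_add f) []. Qed.

Lemma len_split V (B C Z : smod V) : B <<= C -> C <<= Z -> fin B Z ->
  [/\ fin B C, fin C Z & len B Z = (len B C + len C Z)%N].
Proof.
move=> BC CZ f.
have [f1 _] := fin_mono (@sle_refl _ _ B) BC CZ f.
have [f2 _] := fin_mono BC CZ (@sle_refl _ _ Z) f.
by have [_ ->] := len_add f1 f2.
Qed.

Lemma len_eq0 V (B Z : smod V) : B <<= Z -> Z <<= B -> fin B Z /\ len B Z = 0%N.
Proof.
move=> BZ ZB; have m n : chain B Z n -> (n <= 0)%N.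
  case: n => // n [c [c1 c2]]; have [_ []] := c2 0%N isT.
  have [_ h1] := c1 1%N isT; have [h0 _] := c1 0%N isT.
  by move=> x /h1 /ZB /h0.
by split; [split=> //; exists 0%N|apply: len_eq => //; exact: chain0].
Qed.

Lemma len_sadd V (B X Y : smod V) : fin B X -> fin B Y ->
  fin B (sadd X Y) /\ (len B (sadd X Y) <= len B X + len B Y)%N.
Proof.
move=> fX fY; have [BX _] := fX; have [BY _] := fY.
have [f l] : fin X (sadd X Y) /\ (len X (sadd X Y) <= len B Y)%N.
  apply: (len_surj (@id_linear V)) => //; first exact: sadd_l.
  by move=> _ [x [y [Xx Yy ->]]]; exists y => //; rewrite addrK.
have [f' ->] := len_add fX f.
by split=> //; rewrite leq_add2l.
Qed.

End Length.

(** * The graded basis theorem *)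

Section Noetherian.
Variable A : comNzRingType.
Implicit Types V W : lmodType A.

Definition noeth V := forall S : smod V, exists s : seq V, S = sspan s.

Fact union_is_smod V (c : nat -> smod V) (hc : forall n, c n <<= c n.+1) :
  is_smod (fun x => exists n, c n x).
Proof.
split=> [|a x y [i hx] [j hy]]; first by exists 0%N; exact: smod0.
exists (maxn i j); apply: smodL.
  exact: (@incr_le _ _ c (maxn i j) (fun k _ => hc k) i (leq_maxl _ _)).
exact: (@incr_le _ _ c (maxn i j) (fun k _ => hc k) j (leq_maxr _ _)).
Qed.
Definition sunion V (c : nat -> smod V) hc := Smod (@union_is_smod V c hc).

Lemma acc V (c : nat -> smod V) : noeth V -> (forall n, c n <<= c n.+1) ->
  exists n0, forall n, c n <<= c n0.
Proof.
move=> nV hc; have [s hs] := nV (sunion hc).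
have mono i j : (i <= j)%N -> c i <<= c j.
  by move=> ij; apply: (incr_le (k := j)) => // k _; apply: hc.
have [n0 h0] : exists n0, forall x, x \in s -> c n0 x.
  have : forall x, x \in s -> sunion hc x.
    by move=> x xs; rewrite hs; apply: shull_mem.
  elim: s {hs} => [|x s IH] h; first by exists 0%N.
  have [n1 h1] : exists n1, forall x, x \in s -> c n1 x.
    by apply: IH => y ys; apply: h; rewrite inE ys orbT.
  have [n2 h2] := h x (mem_head _ _).
  exists (maxn n1 n2) => y; rewrite inE => /orP[/eqP ->|/h1].
    exact: mono (leq_maxr _ _) _ h2.
  exact: mono (leq_maxl _ _) _.
exists n0 => n x hx; have : sunion hc x by exists n.
by rewrite hs; apply: shull_le.
Qed.

Lemma bounded_upto (f : nat -> nat) n : exists k, forall i, (i <= n)%N -> (f i <= k)%N.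
Proof.
elim: n => [|n [k hk]]; first by exists (f 0%N) => i; rewrite leqn0 => /eqP ->.
exists (maxn k (f n.+1)) => i; rewrite leq_eqVlt => /orP[/eqP->|/hk h].
  exact: leq_maxr.
exact: leq_trans h (leq_maxl _ _).
Qed.

End Noetherian.

Section Graded.
Variables (A : comNzRingType) (V : lmodType A).
Implicit Types (S T : smod V) (B Z W : nat -> smod V) (xs : seq A).

Definition xsum xs (S : smod V) : smod V :=
  shull (fun z => exists x y, [/\ x \in xs, S y & z = x *: y]).

Lemma xsum_mem xs S x y : x \in xs -> S y -> xsum xs S (x *: y).
Proof. by move=> hx hy; apply: shull_mem; exists x, y. Qed.

Lemma xsum_le xs (S T : smod V) :
  (forall x y, x \in xs -> S y -> T (x *: y)) -> xsum xs S <<= T.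
Proof. by move=> h; apply: shull_le => _ [x [y [hx hy ->]]]; apply: h. Qed.

Lemma xsum_cons x xs S :
  xsum (x :: xs) S <<= sadd (simg (scale_linear x) S) (xsum xs S).
Proof.
apply: xsum_le => y v; rewrite inE => /orP[/eqP->|hy] hv.
  by apply: sadd_l; exists v.
by apply: sadd_r; apply: xsum_mem.
Qed.

(** This makes the direct sum of the Z_n a graded module over a polynomial ring with one variable
    for each member of [xs], acting as multiplication from degree n to n + 1. *)
Definition gstab xs Z := forall x n v, x \in xs -> Z n v -> Z n.+1 (x *: v).

(** The graded module with pieces Z_n / B_n is generated in bounded degrees. *)
Definition egen xs B Z :=
  exists n0, forall n, (n0 <= n)%N -> Z n.+1 <<= sadd (B n.+1) (xsum xs (Z n)).

(** The graded submodule B + x Z. The variable of [x] acts as zero on the quotient of [Z] by it,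
    which leaves one variable less. *)
Definition shiftadd x B Z n : smod V :=
  if n is k.+1 then sadd (B n) (simg (scale_linear x) (Z k)) else B 0%N.

Section Shift.
Variables (x : A) (xs : seq A) (B Z : nat -> smod V).
Hypotheses (BZ : forall n, B n <<= Z n).
Hypotheses (sB : gstab (x :: xs) B) (sZ : gstab (x :: xs) Z).

Lemma gstab_behead W : gstab (x :: xs) W -> gstab xs W.
Proof. by move=> h y n v hy; apply: h; rewrite inE hy orbT. Qed.

Lemma shiftadd_l n : B n <<= shiftadd x B Z n.
Proof. by case: n => [|n] //=; apply: sadd_l. Qed.

Lemma shiftadd_r n v : Z n v -> shiftadd x B Z n.+1 (x *: v).
Proof. by move=> h; apply: sadd_r; exists v. Qed.

Lemma shiftadd_le n : shiftadd x B Z n <<= Z n.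
Proof.
case: n => [|n] //=; apply: sadd_le => // _ [v hv ->].
by apply: sZ => //; rewrite mem_head.
Qed.

Lemma gstab_shiftadd : gstab xs (shiftadd x B Z).
Proof.
move=> y [|n] v hy; have hy' : y \in x :: xs by rewrite inE hy orbT.
  by move=> hv; apply: shiftadd_l; apply: sB.
case=> [b [_ [hb [z hz ->] ->]]]; rewrite scalerDr scalerA mulrC -scalerA.
apply: smodD; first by apply: shiftadd_l; apply: sB.
by apply: shiftadd_r; apply: sZ.
Qed.

Lemma egen_shiftadd : egen (x :: xs) B Z -> egen xs (shiftadd x B Z) Z.
Proof.
case=> n0 h; exists n0 => n /h hn v /hn [b [u [hb /xsum_cons [w [t [hw ht ->]]] ->]]].
exists (b + w), t; split=> //; last by rewrite addrA.
by exists b, w.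
Qed.

End Shift.

(* Hilbert's basis theorem in graded form: induction on xs, filtering W by the
   submodules (W : x^j) modulo x Z, which increase with j. *)
Theorem hilbert_basis xs B Z W : noeth V -> (forall n, B n <<= W n) ->
  (forall n, W n <<= Z n) -> gstab xs B -> gstab xs Z -> gstab xs W ->
  egen xs B Z -> egen xs B W.
Proof.
move=> nV; elim: xs B Z W => [|x xs IH] B Z W BW WZ sB sZ sW gZ.
  case: gZ => n0 h; exists n0 => n hn v /WZ /(h n hn) [b [u [hb hu ->]]].
  exists b, u; split=> //; suff : xsum [::] (Z n) <<= xsum [::] (W n) by apply.
  by apply: xsum_le => y w; rewrite in_nil.
have BZ n : B n <<= Z n by apply: sle_trans (WZ n).
pose B' := shiftadd x B Z.
pose X j n := sadd (B' n) (scap (Z n) (spre (scale_linear (x ^+ j)) (W (n + j)%N))).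
have xin : x \in x :: xs by rewrite mem_head.
have XZ j n : X j n <<= Z n by apply: sadd_le; [exact: (shiftadd_le BZ sZ)|move=> v []].
have B'X j n : B' n <<= X j n by exact: sadd_l.
have sX j : gstab xs (X j).
  move=> y n _ hy [b [u [hb [hu1 hu2] ->]]]; rewrite scalerDr.
  have hy' : y \in x :: xs by rewrite inE hy orbT.
  apply: smodD.
    by apply: sadd_l; apply: (gstab_shiftadd sB sZ).
  apply: sadd_r; split; first exact: sZ.
  by rewrite /= scalerA mulrC -scalerA addSn; apply: sW.
have incX n j : X j n <<= X j.+1 n.
  apply: sadd_le; first exact: sadd_l.
  move=> v [h1 h2]; apply: sadd_r; split=> //=.
  by rewrite exprS -scalerA addnS; apply: sW.
have monoX n i j : (i <= j)%N -> X i n <<= X j n.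
  by apply: (incr_le (c := X^~ n)) => k _; apply: incX.
have IH' : forall Y, (forall n, B' n <<= Y n) -> (forall n, Y n <<= Z n) ->
    gstab xs Y -> egen xs B' Y.
  move=> Y h1 h2 h3; apply: (IH B' Z Y) => //; first exact: gstab_shiftadd.
    exact: gstab_behead sZ.
  exact: egen_shiftadd.
pose Xoo n := sunion (incX n).
have [noo hoo] : egen xs B' Xoo.
  apply: IH' => [n v hv|n v [j]|y n v hy [j hj]]; last 1 first.
  - by exists j; apply: sX.
  - by exists 0%N; apply: sadd_l.
  - exact: XZ.
(* The degrees up to [noo] stabilize at a common j0 by the ascending chain condition; in higher
   degrees the union is generated from below, so the same j0 works. *)
have [j0 hj0] : exists j0, forall n, Xoo n <<= X j0 n.
  have /choice [f hf] : forall n, exists k, forall j, X j n <<= X k n.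
    by move=> n; apply: acc.
  have [j0 hj] := bounded_upto f noo.
  exists j0; elim=> [|n IHn].
    move=> v [j /hf hv].
    exact: monoX (hj 0%N _) v hv.
  have [hn|hn] := leqP n.+1 noo.
    move=> v [j /hf hv].
    exact: monoX (hj _ hn) v hv.
  rewrite ltnS in hn; apply: sle_trans (hoo n hn) _.
  apply: sadd_le; first exact: sadd_l.
  by apply: xsum_le => y v hy /IHn; apply: sX.
have /choice [N hN] j : exists n0, forall n, (n0 <= n)%N ->
    X j n.+1 <<= sadd (B' n.+1) (xsum xs (X j n)) by apply: IH'.
have [N0 hN0] := bounded_upto N j0.
exists (j0 + N0)%N => n hn.
set G := sadd _ _.
have BG : B n.+1 <<= G by exact: sadd_l.
have xG y w : y \in x :: xs -> W n w -> G (y *: w).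
  by move=> *; apply: sadd_r; apply: xsum_mem.
have GW : G <<= W n.+1.
  by apply: sadd_le => //; apply: xsum_le => y w hy hw; apply: sW.
(* An element of W_(n+1) is the case j = 0. The proof trades degree for powers of x: a part x z of v
   turns x^j v into x^(j+1) z with z one degree lower, so induction on i applies. *)
suff key : forall i j, (i + j = n.+1)%N -> forall v, Z i v -> W n.+1 (x ^+ j *: v) ->
    G (x ^+ j *: v).
  move=> v hv; have := key n.+1 0%N; rewrite addn0 expr0 => /(_ erefl v).
  by rewrite scale1r; apply=> //; apply: WZ.
have xjB j : forall i v, (i + j)%N = n.+1 -> B i v -> G (x ^+ j *: v).
  move=> i v e hv; apply: BG; rewrite -e.
  elim: (j) => [|l IHl]; first by rewrite addn0 expr0 scale1r.
  by rewrite addnS exprS -scalerA; apply: sB.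
elim=> [|i IHi] j e v hv hW; have [hj|hj] := leqP j j0.
- by lia.
- have : X j.-1 0%N v.
    apply: (monoX _ j0); first by lia.
    apply: hj0; exists j; apply: sadd_r; split=> //=.
    by rewrite e.
  case=> b [u [hb [hu1 hu2] ->]]; rewrite scalerDr.
  apply: smodD; first exact: (xjB j 0%N).
  have ->: j = j.-1.+1 by lia.
  rewrite exprS -scalerA; apply: xG => //.
  by move: hu2; rewrite /=; have -> : (0 + j.-1)%N = n by lia.
(* For j <= j0 the degree is beyond the generation bound of X_j, so up to B + x Z the element v is a
   combination of lower elements u with x^j u in W_n. *)
- have : X j i.+1 v by apply: sadd_r; split=> //=; rewrite e.
  have Ni : (N j <= i)%N by have := hN0 j hj; lia.
  case/(hN j i Ni) => b [u [hb hu vE]].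
  have [u1 [u2 [hu1 hu2 uE]]] : sadd (B' i.+1) (xsum xs (scap (Z i)
      (spre (scale_linear (x ^+ j)) (W (i + j)%N)))) u.
    move: u hu {vE}; apply: xsum_le => y _ hy [c [w [hc hw ->]]]; rewrite scalerDr.
    exists (y *: c), (y *: w); split=> //; last exact: xsum_mem.
    exact: (gstab_shiftadd sB sZ).
  have {hb hu1} [b1 [_ [hb1 [z hz ->] bE]]] : B' i.+1 (b + u1) by apply: smodD.
  have vE' : v = b1 + x *: z + u2 by rewrite vE uE addrA bE.
  have g1 : G (x ^+ j *: b1) by apply: (xjB j i.+1).
  have g2 : G (x ^+ j *: u2).
    move: u2 hu2 {uE vE'}.
    suff : xsum xs (scap (Z i) (spre (scale_linear (x ^+ j)) (W (i + j)%N)))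
      <<= spre (scale_linear (x ^+ j)) G by [].
    apply: xsum_le => y w hy [_ /= hw]; rewrite scalerA mulrC -scalerA.
    apply: xG; first by rewrite inE hy orbT.
    by move: hw; have -> : (i + j)%N = n by lia.
  have E : x ^+ j *: v = x ^+ j *: b1 + x ^+ j.+1 *: z + x ^+ j *: u2.
    by rewrite vE' !scalerDr exprSr -scalerA.
  rewrite E; apply: smodD => //; apply: smodD => //.
  apply: (IHi j.+1) => //; first by lia.
  have -> : x ^+ j.+1 *: z = x ^+ j *: v - x ^+ j *: u2 - x ^+ j *: b1.
    by rewrite E addrK addrC addKr.
  by apply: smodB; [apply: smodB => //|]; apply: GW.
(* For j > j0 the sequence X is already stable, so the exponent j - 1 suffices, and the spare factor
   x is the multiplier needed in [G]. *)
- have : X j.-1 i.+1 v.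
    apply: (monoX _ j0); first by lia.
    apply: hj0; exists j; apply: sadd_r; split=> //=.
    by rewrite e.
  case=> _ [u [[b [_ [hb [z hz ->] ->]]] [hu1 hu2] vE]].
  have g1 : G (x ^+ j *: b) by apply: (xjB j i.+1).
  have g2 : G (x ^+ j *: u).
    have ->: j = j.-1.+1 by lia.
    rewrite exprS -scalerA; apply: xG => //.
    by move: hu2; rewrite /=; have -> : (i.+1 + j.-1)%N = n by lia.
  have E : x ^+ j *: v = x ^+ j *: b + x ^+ j.+1 *: z + x ^+ j *: u.
    by rewrite vE !scalerDr exprSr -scalerA.
  rewrite E; apply: smodD => //; apply: smodD => //.
  apply: (IHi j.+1) => //; first by lia.
  have -> : x ^+ j.+1 *: z = x ^+ j *: v - x ^+ j *: u - x ^+ j *: b.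
    by rewrite E addrK addrC addKr.
  by apply: smodB; [apply: smodB => //|]; apply: GW.
Qed.

End Graded.

(** * Eventually polynomial functions and the Hilbert-Serre theorem *)

Section EventuallyPolynomial.
Implicit Types (h f g : nat -> int) (r n : nat).

Definition delta h n : int := h n.+1 - h n.

(** [h] is eventually a polynomial of degree less than [r]; with differences no coefficients have to
    be named. *)
Definition ep r h := exists n0, forall n, (n0 <= n)%N -> iter r delta h n = 0.

Lemma ep_delta r h : ep r (delta h) <-> ep r.+1 h.
Proof. by split=> -[n0 H]; exists n0 => n hn; have := H n hn; rewrite -iterSr. Qed.

Lemma ep_mono r s h : (r <= s)%N -> ep r h -> ep s h.
Proof.
move=> /subnK <-; elim: (s - r)%N => [//|k IH] /IH [n0 H]; exists n0 => n hn.
by rewrite addSn iterS /delta !H // ltnW.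
Qed.

Lemma iter_delta_lin r a f g n : iter r delta (fun k => a * f k + g k) n =
  a * iter r delta f n + iter r delta g n.
Proof.
by elim: r n => [//|r IH] n; rewrite !iterS /delta !IH; ring.
Qed.

Lemma ep_lin r a f g : ep r f -> ep r g -> ep r (fun n => a * f n + g n).
Proof.
move=> [n0 F] [n1 G]; exists (maxn n0 n1) => n; rewrite geq_max => /andP[h0 h1].
by rewrite iter_delta_lin F // G // mulr0 addr0.
Qed.

Lemma iter_delta_shift r h n : iter r delta (h \o S) n = iter r delta h n.+1.
Proof. by elim: r n => [//|r IH] n; rewrite !iterS /delta !IH. Qed.

Lemma ep_shift r h : ep r h -> ep r (h \o S).
Proof. by case=> n0 H; exists n0 => n hn; rewrite iter_delta_shift H // ltnW. Qed.

Lemma ep_ext r f g : (exists n0, forall n, (n0 <= n)%N -> f n = g n) -> ep r f -> ep r g.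
Proof.
move=> [n0 fg] [n1 F]; exists (maxn n0 n1) => n; rewrite geq_max => /andP[h0 h1].
suff E k : (n0 <= k)%N -> iter r delta f k = iter r delta g k by rewrite -E // F.
elim: r k {F h0 h1} => [k hk|r IH k hk]; first exact: fg.
by rewrite !iterS /delta !IH // ltnW.
Qed.

Lemma leq_expn2r a b e : (a <= b)%N -> (a ^ e <= b ^ e)%N.
Proof. by case: e => [|e] ab; [rewrite !expn0|rewrite leq_exp2r]. Qed.

Lemma ep_bound r h : ep r.+1 h -> exists C, forall n, (`|h n| <= C * n.+1 ^ r)%N.
Proof.
elim: r h => [|r IH] h.
  case=> n0 H; have [k hk] := bounded_upto (fun n => `|h n|%N) n0.
  exists k => n; rewrite expn0 muln1; have [/hk//|hn] := leqP n n0.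
  suff -> : h n = h n0 by apply: hk.
  move: hn => /ltnW/subnK <-; elim: (n - n0)%N => [//|j <-].
  have := H (j + n0)%N (leq_addl _ _).
  by rewrite /= /delta addSn => /eqP; rewrite subr_eq0 => /eqP.
move=> /ep_delta /IH [C hC]; exists (`|h 0%N| + C)%N => n.
have claim : (`|h n| <= `|h 0%N| + n * (C * n.+1 ^ r))%N.
  elim: n => [|n IHn]; first by rewrite mul0n addn0.
  have -> : h n.+1 = h n + delta h n by rewrite /delta addrC subrK.
  apply: leq_trans (_ : (`|h n| + `|delta h n| <= _)%N); first by lia.
  apply: leq_trans (leq_add IHn (hC n)) _.
  rewrite -addnA leq_add2l addnC -mulSn leq_mul2l /= leq_mul2l.
  by rewrite leq_expn2r ?orbT // ltnW.
apply: leq_trans claim _; rewrite mulnDl; apply: leq_add.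
  by rewrite leq_pmulr // expn_gt0.
by rewrite expnS mulnCA leq_mul2l leq_mul ?orbT.
Qed.

Lemma iter_delta_bin r n : iter r delta (fun k => 'C(k, r)%:Z) n = 1.
Proof.
elim: r n => [n|r IH n]; first by rewrite /= bin0.
rewrite iterSr -[RHS](IH n); congr (iter r delta _ n); apply/funext => k.
by rewrite /delta binS PoszD addrAC subrr add0r.
Qed.

Lemma ffact_le_expn n k : (n ^_ k <= n ^ k)%N.
Proof. by elim: k => [//|k IH]; rewrite ffactnSr expnSr leq_mul // leq_subr. Qed.

Lemma ffact_bound r : exists K, forall n, (n ^ r.+1 <= n ^_ r.+1 + K * n ^ r)%N.
Proof.
elim: r => [|r [K hK]]; first by exists 0%N => n; rewrite expn1 ffactn1 leq_addr.
exists (K + r.+1)%N => n; rewrite expnSr ffactnSr.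
apply: leq_trans (leq_mul (hK n) (leqnn n)) _.
have l := ffact_le_expn n r.+1.
have -> : ((n ^_ r.+1 + K * n ^ r) * n = n ^_ r.+1 * n + K * n ^ r.+1)%N.
  by rewrite mulnDl -mulnA -expnSr.
have : (n ^_ r.+1 * n <= n ^_ r.+1 * (n - r.+1) + n ^_ r.+1 * r.+1)%N.
  by rewrite -mulnDr leq_mul2l; apply/orP; right; lia.
have : (n ^_ r.+1 * r.+1 <= n ^ r.+1 * r.+1)%N by rewrite leq_mul2r l orbT.
rewrite (mulnDl K) (mulnC (n ^ r.+1)%N); lia.
Qed.

(** Here c is the eventual value of the difference of order r + 1. Subtracting c times the binomial
    C(n, r + 1) lowers the order, so [ep_bound] applies to the rest; replacing the falling factorial
    by n^(r+1) costs O(n^r). *)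
Lemma ep_lead r h : ep r.+2 h -> exists c : int, exists K,
  (exists n0, forall n, (n0 <= n)%N -> iter r.+1 delta h n = c) /\
  forall n, (`| ((r.+1)`!%:Z * h n - c * (n ^ r.+1)%N%:Z)%R | <= K * n.+1 ^ r)%N.
Proof.
case=> n0 H; pose c := iter r.+1 delta h n0.
have hc n : (n0 <= n)%N -> iter r.+1 delta h n = c.
  move/subnK <-; elim: (n - n0)%N => [//|j IHj]; rewrite addSn -IHj.
  by have := H (j + n0)%N (leq_addl _ _); rewrite iterS {1}/delta => /eqP;
    rewrite subr_eq0 => /eqP.
pose g n := (- c) * 'C(n, r.+1)%:Z + h n.
have /ep_bound [C hC] : ep r.+1 g.
  exists n0 => n hn; rewrite /g iter_delta_lin iter_delta_bin hc //; ring.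
have [K hK] := ffact_bound r.
exists c, ((r.+1)`! * C + `|c| * K)%N; split; first by exists n0.
move=> n; have -> : (r.+1)`!%:Z * h n - c * (n ^ r.+1)%N%:Z =
    (r.+1)`!%:Z * g n + c * ((n ^_ r.+1)%:Z - (n ^ r.+1)%N%:Z).
  rewrite /g -bin_ffact PoszM; ring.
have l := ffact_le_expn n r.+1.
apply: leq_trans (_ : ((r.+1)`! * `|g n| + `|c| * (n ^ r.+1 - n ^_ r.+1) <= _)%N).
  apply: leq_trans (_ : (`|((r.+1)`!%:Z * g n)%R| +
      `|(c * ((n ^_ r.+1)%N%:Z - (n ^ r.+1)%N%:Z))%R| <= _)%N).
    by lia.
  rewrite !abszM; apply: leq_add => //; rewrite leq_mul2l.
  by apply/orP; right; lia.
rewrite mulnDl; apply: leq_add; rewrite -[X in (_ <= X)%N]mulnA leq_mul2l.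
  by rewrite hC orbT.
apply/orP; right; apply: leq_trans (_ : (K * n ^ r <= _)%N); last first.
  by rewrite leq_mul2l leq_expn2r ?orbT.
by rewrite leq_subLR.
Qed.

(** If the order exceeds s + 1, growth of order n^s is too slow for a nonzero leading coefficient,
    so the order goes down by one at a time. *)
Lemma ep_drop r s h C : ep r h -> (forall n, (`|h n| <= C * n.+1 ^ s)%N) -> ep s.+1 h.
Proof.
elim: r => [|r IH] hr hC; first exact: ep_mono hr.
have [|lt] := leqP r.+1 s.+1; first by move=> l; apply: ep_mono hr.
case: r IH hr lt => [//|r] IH /ep_lead [c [K [[n0 hn0] hK]]] lt.
apply: IH => //; exists n0 => n /hn0 ->.
pose D := (K + (r.+1)`! * C)%N.
have b n' : (`|c| * n' ^ r.+1 <= D * n'.+1 ^ r)%N.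
  apply: leq_trans (_ : (`|((r.+1)`!%:Z * h n' - c * (n' ^ r.+1)%N%:Z)%R| +
      (r.+1)`! * `|h n'| <= _)%N).
    have : `|(c * (n' ^ r.+1)%N%:Z)%R|%N = (`|c| * n' ^ r.+1)%N by rewrite abszM.
    have : `|((r.+1)`!%:Z * h n')%R|%N = ((r.+1)`! * `|h n'|)%N by rewrite abszM.
    by lia.
  rewrite /D mulnDl; apply: leq_add => //; rewrite -mulnA leq_mul2l.
  apply/orP; right; apply: leq_trans (hC n') _.
  by rewrite leq_mul2l leq_pexp2l ?orbT.
apply/eqP; rewrite -absz_eq0 -leqn0 leqNgt; apply/negP => c0.
(* With this value D (n' + 1)^r <= D (2 n')^r < n' n'^r, which contradicts [b] if c is nonzero. *)
pose n' := (D * 2 ^ r).+1.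
have := b n'; apply/negP; rewrite -ltnNge.
apply: leq_ltn_trans (_ : (D * (2 * n') ^ r < _)%N).
  by rewrite leq_mul2l leq_expn2r ?orbT // /n'; lia.
rewrite expnMn mulnA expnS mulnA ltn_mul2r.
apply/andP; split; first by rewrite expn_gt0.
apply: leq_trans (_ : (1 * n' <= _)%N); last by rewrite leq_mul2r c0 orbT.
by rewrite mul1n /n'.
Qed.

(** The limit is an integer because it is the eventual value of the difference of order d - 1 of an
    integer-valued function. *)
Lemma ep_lim (R : realType) d h : (0 < d)%N -> ep d h -> exists c : int,
  (fun n : nat => d.-1`!%:R / n%:R ^+ d.-1 * (h n)%:~R : R) @ \oo --> (c%:~R : R).
Proof.
case: d => [//|[|r]] _ /=.
  case=> n0 H; exists (h n0); apply: cvg_near_cst; exists n0 => // n /= hn.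
  rewrite fact0 expr0 divr1 mul1r; congr (_%:~R).
  move: hn => /subnK <-; elim: (n - n0)%N => [//|j <-].
  have := H (j + n0)%N (leq_addl _ _).
  by rewrite /= /delta addSn => /eqP; rewrite subr_eq0 => /eqP.
case/ep_lead => c [K [_ hK]]; exists c.
(* The error is at most K (n + 1)^r / n^(r+1), hence at most K 2^(r+1) / (n + 1) once n >= 1. *)
have hh : (fun n => (K * 2 ^ r.+1)%:R * harmonic n : R) @ \oo --> (0 : R).
  by rewrite -[X in _ --> X](mulr0 (K * 2 ^ r.+1)%:R); apply: cvgMr; exact: cvg_harmonic.
apply/cvgrPdist_le => e e0; move/cvgrPdist_le: hh => /(_ e e0) [n1 _ hn1].
exists (maxn n1 1%N) => // n; rewrite /= geq_max => /andP[h1 h2].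
apply: le_trans (hn1 n h1); rewrite sub0r normrN [X in _ <= X]ger0_norm; last first.
  by apply: mulr_ge0 => //; rewrite /harmonic /= invr_ge0.
have n0 : (0 : R) < n%:R by rewrite ltr0n.
have nr0 : (n%:R ^+ r.+1 : R) != 0 by rewrite expf_neq0 // gt_eqF.
have -> : c%:~R - (r.+1)`!%:R / n%:R ^+ r.+1 * (h n)%:~R =
   - (((r.+1)`!%:Z * h n - c * (n ^ r.+1)%N%:Z)%:~R / n%:R ^+ r.+1) :> R.
  by rewrite intrB !intrM -!pmulrn natrX; field.
rewrite normrN normrM normfV (ger0_norm (exprn_ge0 _ (ltW n0))).
rewrite ler_pdivrMr ?exprn_gt0 // -intr_norm -abszE /=.
rewrite /harmonic /= mulrAC ler_pdivlMr ?ltr0n //.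
rewrite -natrX -!natrM ler_nat.
apply: leq_trans (leq_mul (hK n) (leqnn _)) _.
rewrite -mulnA -expnSr -mulnA -expnMn leq_mul2l leq_expn2r ?orbT //; lia.
Qed.

End EventuallyPolynomial.

Section HilbertSerre.
Variables (A : comNzRingType) (V : lmodType A).

(** Multiplication by x gives the exact sequence 0 -> K_n/B_n -> Z_n/B_n -> Z_(n+1)/B_(n+1) ->
    Z_(n+1)/B'_(n+1) -> 0. On the kernel and the cokernel the variable of x acts as zero, so
    induction applies to both, and the first difference of the length is the difference of their
    lengths. *)
Theorem hilbert_serre (xs : seq A) (B Z : nat -> smod V) : noeth V ->
  gstab xs B -> gstab xs Z -> egen xs B Z -> (forall n, fin (B n) (Z n)) ->
  ep (size xs) (fun n => (len (B n) (Z n))%:Z).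
Proof.
move=> nV; elim: xs B Z => [|x xs IH] B Z sB sZ gZ fZ.
  case: gZ => n0 h; exists n0.+1 => -[//|n] hn /=; congr Posz.
  have [BZ _] := fZ n.+1; apply: (len_eq0 BZ _).2.
  apply: sle_trans (h n hn) _; apply: sadd_le => //.
  by apply: xsum_le => y w; rewrite in_nil.
have BZ n : B n <<= Z n by case: (fZ n).
pose K n := scap (Z n) (spre (scale_linear x) (B n.+1)).
pose B' := shiftadd x B Z.
have BK n : B n <<= K n.
  by move=> v hv; split; [apply: BZ|apply: sB; rewrite ?mem_head].
have KZ n : K n <<= Z n by move=> v [].
have B'Z n : B' n <<= Z n by apply: (shiftadd_le BZ sZ).
have BB' n : B n <<= B' n by apply: shiftadd_l.
have sK : gstab (x :: xs) K.
  move=> y n v hy [h1 h2]; split; first exact: sZ.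
  by rewrite /= scalerA mulrC -scalerA; apply: sB.
have epK : ep (size xs) (fun n => (len (B n) (K n))%:Z).
  apply: IH => [|||n]; [exact: gstab_behead sB|exact: gstab_behead sK| |].
    (* The kernel inherits generation from [Z] by the basis theorem; as x K_n lies in B_(n+1), the
       generator x can then be dropped. *)
    have [n0 hn] : egen (x :: xs) B K by apply: (hilbert_basis nV _ KZ _ _ _ gZ).
    exists n0 => n /hn h v /h [b [u [hb /xsum_cons [_ [t [[w [_ hw] ->] ht ->]]] ->]]].
    exists (b + x *: w), t; split=> //; last by rewrite addrA.
    exact: smodD.
  by have [] := len_split (BK n) (KZ n) (fZ n).
have epC : ep (size xs) (fun n => (len (B' n) (Z n))%:Z).
  apply: IH => [|||n].
  - exact: gstab_shiftadd.
  - exact: gstab_behead sZ.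
  - exact: egen_shiftadd.
  - by have [] := len_split (BB' n) (B'Z n) (fZ n).
apply/ep_delta.
apply: ep_ext (ep_lin (-1) epK (ep_shift epC)); exists 0%N => n _.
rewrite /delta /=.
have [_ _ ->] := len_split (BB' n.+1) (B'Z n.+1) (fZ n.+1).
have [_ fKZ ->] := len_split (BK n) (KZ n) (fZ n).
have [v hv|v hv|_ [b [_ [hb [v hv ->] ->]]]||_ _ <-] :=
    len_iso (scale_linear x) (KZ n) (BB' n.+1).
- by split=> [[]|].
- exact: shiftadd_r.
- by exists v => //; rewrite addrK.
- by left.
- by rewrite !PoszD mulN1r; ring.
Qed.

End HilbertSerre.

(** * Growth of filtrations *)

Section Growth.
Variable A : comNzRingType.
Implicit Types (V : lmodType A) (J K : smod A^o).

Definition powm V J n (S : smod V) := iter n (smulm J) S.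
Definition ipow J n : smod A^o := powm J n (sfull A^o).

Lemma smulmA V J K (S : smod V) : smulm J (smulm K S) = smulm (smulm J K) S.
Proof.
apply: smod_ext.
  apply: smulm_le => a x ha.
  suff : smulm K S <<= spre (scale_linear a) (smulm (smulm J K) S) by apply.
  apply: smulm_le => b y hb hy; rewrite /= scalerA.
  exact: (smulm_mem (smulm_mem (S := K) ha hb) hy).
apply: smulm_le => a x + hx; move: a.
have lx : linear (fun a : A^o => (a : A) *: x).
  by move=> c y z; rewrite scalerDl scalerA.
suff : smulm J K <<= spre lx (smulm J (smulm K S)) by move=> h a /h.
apply: smulm_le => a b ha hb.
suff : smulm J (smulm K S) (a *: ((b : A) *: x)) by rewrite scalerA.
by apply: smulm_mem => //; apply: smulm_mem.
Qed.

Lemma smulm1 V (S : smod V) : smulm (sfull A^o) S = S.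
Proof.
apply: smod_ext; first exact: smulm_sub.
by move=> x hx; rewrite -[x]scale1r; apply: (smulm_mem (a := 1)).
Qed.

Lemma smulm_ipow V J n (S : smod V) : smulm (ipow J n) S = powm J n S.
Proof.
elim: n => [|n IH]; first exact: smulm1.
by rewrite /ipow /powm !iterS -smulmA -/(powm J n S) -IH.
Qed.

Lemma powm_mono V J K n (S : smod V) : J <<= K -> powm J n S <<= powm K n S.
Proof. by move=> JK; elim: n => [//|n IH]; apply: smulm_mono. Qed.

Lemma powm_le V J n (S : smod V) : powm J n S <<= S.
Proof. by elim: n => [//|n IH]; apply: sle_trans IH; apply: smulm_sub. Qed.

Lemma powm_anti V J n k (S : smod V) : (k <= n)%N -> powm J n S <<= powm J k S.
Proof.
move=> /subnK <-; rewrite /powm iterD; exact: powm_le.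
Qed.

Lemma smulm_span V (xs : seq A) (S : smod V) :
  smulm (sspan (xs : seq A^o)) S <<= xsum xs S.
Proof.
apply: smulm_le => a x + hx; move: a.
have lx : linear (fun a : A^o => (a : A) *: x).
  by move=> c y z; rewrite scalerDl scalerA.
suff : sspan (xs : seq A^o) <<= spre lx (xsum xs S) by move=> h a /h.
by apply: shull_le => y hy; apply: xsum_mem.
Qed.

Section OneIdeal.
Variables (V : lmodType A) (nV : noeth V) (xs : seq A) (S : smod V).
Let J : smod A^o := sspan (xs : seq A^o).
Hypothesis fJ : forall n, fin (powm J n S) S.

Lemma fin_pow n k : (n <= k)%N -> fin (powm J k S) (powm J n S).
Proof.
by move=> nk; apply: fin_sub (fJ k) => //; [apply: powm_anti|apply: powm_le].
Qed.

Lemma ep_pow : ep (size xs) (fun n => (len (powm J n.+1 S) (powm J n S))%:Z).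
Proof.
have st : gstab xs (powm J ^~ S).
  move=> x n v hx hv; apply: smulm_mem => //; exact: shull_mem.
apply: hilbert_serre => //.
- by move=> x n v hx hv; apply: st.
- exists 0%N => n _ v hv; apply: sadd_r; exact: smulm_span.
- by move=> n; apply: fin_pow.
Qed.

Lemma len_powS n k : (n <= k)%N -> len (powm J k.+1 S) (powm J n S) =
  (len (powm J k.+1 S) (powm J k S) + len (powm J k S) (powm J n S))%N.
Proof.
by move=> nk; rewrite (len_add (fin_pow (leqnSn k)) (fin_pow nk)).2.
Qed.

Lemma ep_pow_sum : ep (size xs).+1 (fun n => (len (powm J n S) S)%:Z).
Proof.
apply/ep_delta; apply: ep_ext ep_pow; exists 0%N => n _.
by rewrite /delta (len_powS (leq0n n)) PoszD addrK.
Qed.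

End OneIdeal.

Section Filtration.
Variables (V : lmodType A) (nV : noeth V) (S : smod V).
Variables (xs ys : seq A).
Let I : smod A^o := sspan (xs : seq A^o).
Let Q : smod A^o := sspan (ys : seq A^o).
Hypotheses (QI : Q <<= I) (fQ : forall n, fin (powm Q n S) S).
Hypothesis ys0 : (0 < size ys)%N.

Lemma fin_pow_sup n : fin (powm I n S) S.
Proof.
by apply: fin_sub (fQ n) => //; [apply: powm_mono|apply: powm_le].
Qed.

(** The number of generators of I gives a polynomial, but of too high a degree. Since Q lies in I,
    S/I^n S is no longer than S/Q^n S, whose length has degree at most the number of generators of
    Q; [ep_drop] transfers this bound. *)
Lemma pow_bound : exists C, forall n,
  (len (powm I n.+1 S) (powm I n S) <= C * n.+1 ^ (size ys).-1)%N.
Proof.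
have [C hC] := ep_bound (ep_pow_sum nV fQ).
have /ep_drop : ep (size xs).+1 (fun n => (len (powm I n S) S)%:Z).
  exact: ep_pow_sum fin_pow_sup.
move=> /(_ (size ys) C) [n|n0 hn0].
  have [_ l] := fin_mono (@powm_mono V Q I n S QI) (@powm_le V I n S) (@sle_refl _ _ S) (fQ n).
  exact: leq_trans l (hC n).
have : ep (size ys).-1.+1 (fun n => (len (powm I n.+1 S) (powm I n S))%:Z).
  rewrite prednK //.
  have /ep_delta : ep (size ys).+1 (fun n => (len (powm I n S) S)%:Z) by exists n0.
  apply: ep_ext; exists 0%N => n _.
  by rewrite /delta (len_powS fin_pow_sup (leq0n n)) PoszD addrK.
by case/ep_bound => D hD; exists D.
Qed.

(** The index is shifted: [F n] stands for the member I_(n+1) of the filtration, the one that enters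
    e^T. In the application [V] is a presentation and [S] its kernel, so that Zn/(F_n S) is a
    Tor_1. *)
Variable F : nat -> smod A^o.
Hypothesis IF : forall n, ipow I n.+1 <<= F n.
Hypothesis FI : forall n, smulm I (F n) <<= F n.+1.
Hypothesis FE : exists n0, forall n, (n0 <= n)%N -> F n.+1 = smulm I (F n).

Let Zn n := scap S (smulm (F n) (sfull V)).

Lemma fin_filt n : fin (smulm (F n) S) S.
Proof.
apply: fin_sub (fin_pow_sup n.+1) => //; last exact: smulm_sub.
by rewrite -smulm_ipow; apply: smulm_mono.
Qed.

Lemma filt_le n : smulm (F n) S <<= Zn n.
Proof. by move=> v hv; split; [apply: smulm_sub hv|apply: smulm_mono v hv]. Qed.

Lemma fin_Zn n : fin (smulm (F n) S) (Zn n).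
Proof.
by apply: fin_sub (@filt_le n) _ (fin_filt n) => // v [].
Qed.

(* Artin-Rees bounds the degree: S \cap F_n V lies in I^(n - n0) S. *)
Theorem ep_filt : ep (size ys)
  (fun n => (len (smulm (F n) S) (scap S (smulm (F n) (sfull V))))%:Z).
Proof.
have sF (T : smod V) : gstab xs (fun n => smulm (F n) T).
  move=> x n v hx hv; suff : smulm (smulm I (F n)) T (x *: v).
    by apply: smulm_mono => //; apply: FI.
  by rewrite -smulmA; apply: smulm_mem => //; apply: shull_mem.
have sZ : gstab xs Zn.
  by move=> x n v hx [h1 h2]; split; [apply: smodZ|apply: sF].
(* The Artin-Rees lemma: the F_n V form a finitely generated graded module over the variables of I,
   hence so do the submodules S \cap F_n V. *)
have gZ : egen xs (fun=> szero V) Zn.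
  apply: (@hilbert_basis _ _ _ _ (fun n => smulm (F n) (sfull V))) => //.
  - by move=> n _ ->; exact: smod0.
  - by move=> n v [].
  - by move=> x n v _ ->; rewrite scaler0.
  - case: FE => n0 h; exists n0 => n /h -> v hv; apply: sadd_r.
    by apply: smulm_span; rewrite smulmA.
have {gZ} [n0 h0] := gZ.
have ar j : Zn (j + n0)%N <<= powm I j S.
  elim: j => [|j IH]; first by move=> v [].
  rewrite addSn; apply: sle_trans (h0 _ (leq_addl _ _)) _; apply: sadd_le.
    by move=> _ ->; exact: smod0.
  apply: xsum_le => x v hx /IH hv; apply: smulm_mem => //; exact: shull_mem.
have ept : ep (size xs) (fun n => (len (smulm (F n) S) (Zn n))%:Z).
  apply: hilbert_serre => //; last exact: fin_Zn.
  exists n0 => n /h0 h v /h [z [w [-> hw ->]]].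
  by exists 0, w; split=> //; exact: smod0.
have [C hC] := pow_bound.
(* Zn/(F_n S) is a subquotient of I^(n-n0) S / I^(n+1) S, which consists of n0 + 1 consecutive
   layers, each bounded by [pow_bound]. *)
have b n : (n0 <= n)%N ->
    (len (smulm (F n) S) (Zn n) <= n0.+1 * C * n.+1 ^ (size ys).-1)%N.
  move=> hn; have Zle : Zn n <<= powm I (n - n0) S by rewrite -{1}(subnK hn).
  have FP : powm I n.+1 S <<= smulm (F n) S.
    by rewrite -smulm_ipow; apply: smulm_mono.
  have [_ l] := fin_mono FP (@filt_le n) Zle
    (fin_pow fin_pow_sup (leq_trans (leq_subr n0 n) (leqnSn n))).
  apply: leq_trans l _.
  have : forall k, (k <= n0)%N -> (len (powm I (n - n0 + k).+1 S) (powm I (n - n0) S)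
      <= k.+1 * (C * n.+1 ^ (size ys).-1))%N.
    elim=> [|k IHk] hk; rewrite (len_powS fin_pow_sup (leq_addr _ _)).
    - rewrite addn0 (len_eq0 (@sle_refl _ _ _) (@sle_refl _ _ _)).2 addn0 mul1n.
      apply: leq_trans (hC _) _; rewrite leq_mul2l leq_expn2r ?orbT //.
      by rewrite ltnS leq_subr.
    - rewrite mulSn; apply: leq_add; last first.
        by rewrite addnS; apply: IHk; apply: ltnW.
      apply: leq_trans (hC _) _; rewrite leq_mul2l leq_expn2r ?orbT //.
      by rewrite ltnS; lia.
  by move=> /(_ n0 (leqnn _)); rewrite subnK // mulnA.
have [D hD] := bounded_upto (fun n => len (smulm (F n) S) (Zn n)) n0.
rewrite -(prednK ys0); apply: (ep_drop (C := (D + n0.+1 * C)%N) ept) => n.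
have [/hD h|/ltnW/b h] := leqP n n0; apply: leq_trans h _.
  by apply: leq_trans (leq_pmulr _ _); rewrite ?leq_addr // expn_gt0.
by rewrite leq_mul2r leq_addl orbT.
Qed.

End Filtration.
End Growth.

(** * Finite length and prime ideals *)

Section FiniteLength.
Variables (A : comNzRingType) (m : smod A^o).
Hypothesis m_max : forall a : A, ~ m a -> exists c : A, m (1 - c * a).
Variables (V : lmodType A) (nV : noeth V).
Implicit Types B Z : smod V.

Definition kills (a : A) Z B := forall z, Z z -> B (a *: z).

(** Z/B is a quotient of the field A/m, so it has no submodules besides zero and itself and no chain
    in it has two steps. *)
Lemma fin_cyclic B Z v : B <<= Z -> Z v ->
  (forall z, Z z -> exists a, B (z - a *: v)) ->
  (forall a : A, m a -> kills a Z B) -> fin B Z.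
Proof.
move=> BZ Zv hv hm; split=> //; exists 1%N => -[|[|n]] // [c [c1 c2]].
have [l01 n01] := c2 0%N isT; have [_ []] := c2 1%N isT.
have [B0 _] := c1 0%N isT; have [_ Z1] := c1 1%N isT; have [_ Z2] := c1 2%N isT.
have [w hw nw] : exists2 w, c 1%N w & ~ c 0%N w.
  apply: contra_notP n01 => h w hw; apply: contra_notP h => h; by exists w.
have [a ha] := hv w (Z1 w hw).
have c1v : c 1%N (a *: v).
  have -> : a *: v = w - (w - a *: v) by rewrite subKr.
  by apply: smodB => //; apply: l01; apply: B0.
have [|e he] := @m_max a.
  by move=> /hm /(_ _ Zv) h; apply: nw; apply: B0; apply: smodBD ha h.
have {}c1v : c 1%N v.
  have -> : v = (1 - e * a) *: v + e *: (a *: v).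
    by rewrite scalerA -scalerDl subrK scale1r.
  by apply: smodD; [apply: l01; apply: B0; apply: hm|apply: smodZ].
move=> z /Z2 /hv [b hb]; apply: (smodBD (y := b *: v)); last exact: smodZ.
by apply: l01; apply: B0.
Qed.

Lemma fin_kill B Z : B <<= Z -> (forall a : A, m a -> kills a Z B) -> fin B Z.
Proof.
move=> BZ hm; have [s hs] := nV Z.
suff [f _] : fin B (sadd B (sspan s)) /\ sadd B (sspan s) <<= Z.
  apply: fin_sub f => //; first by rewrite -hs; apply: sadd_r.
have : forall x, x \in s -> Z x by move=> x hx; rewrite hs; apply: shull_mem.
elim: s {hs} => [|x s IH] hs.
  have E : sadd B (sspan [::]) <<= B.
    by apply: sadd_le => //; apply: shull_le => y; rewrite in_nil.
  split; last exact: sle_trans BZ.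
  by apply: (len_eq0 _ E).1; apply: sadd_l.
have [|f l] := IH; first by move=> y hy; apply: hs; rewrite inE hy orbT.
have Zx : Z x by apply: hs; rewrite mem_head.
have l2 : sadd B (sspan (x :: s)) <<= Z.
  by apply: sadd_le => //; apply: shull_le => y /hs.
split=> //.
apply: (fin_trans f); apply: (@fin_cyclic _ _ x).
- apply: sadd_le; first exact: sadd_l.
  apply: shull_le => y hy; apply: sadd_r; apply: shull_mem.
  by rewrite inE hy orbT.
- by apply: sadd_r; apply: shull_mem; rewrite mem_head.
- move=> _ [b [t [hb ht ->]]].
  suff [a ha] : exists a, sspan s (t - a *: x).
    by exists a; rewrite -addrA; exists b, (t - a *: x).
  have P : is_smod (fun t => exists a, sspan s (t - a *: x)).
    split=> [|c y z [a ha] [b' hb']].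
      by exists 0; rewrite scale0r subr0; exact: smod0.
    exists (c * a + b').
    have -> : c *: y + z - (c * a + b') *: x = c *: (y - a *: x) + (z - b' *: x).
      by rewrite scalerDl -scalerA opprD addrACA scalerBr.
    exact: smodL.
  apply: (ht (Smod P)) => y; rewrite inE => /orP[/eqP ->|hy].
    by exists 1; rewrite scale1r subrr; exact: smod0.
  by exists 0; rewrite scale0r subr0; apply: shull_mem.
- by move=> a ha z /l2 hz; apply: sadd_l; apply: hm ha _ hz.
Qed.

(** The list [rest] collects the generators of m that already kill Z/B; when all have moved there,
    Z/B is killed by m and [fin_kill] applies. *)
Lemma fin_powers (gs rest : seq A) B Z : B <<= Z ->
  m <<= sspan ((gs ++ rest : seq A) : seq A^o) ->
  (forall g, g \in gs -> exists k, kills (g ^+ k) Z B) ->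
  (forall g, g \in rest -> kills g Z B) -> fin B Z.
Proof.
elim: gs rest B Z => [|g gs IH] rest B Z BZ hm hg hr.
  apply: fin_kill => // a /hm ha z Zz.
  have lz : linear (fun a : A^o => (a : A) *: z).
    by move=> c y y'; rewrite scalerDl scalerA.
  suff : sspan (rest : seq A^o) <<= spre lz B by apply.
  by apply: shull_le => b /hr; apply.
have [k] := hg g (mem_head _ _).
have {hg} hg : forall g, g \in gs -> exists k, kills (g ^+ k) Z B.
  by move=> h hh; apply: hg; rewrite inE hh orbT.
elim: k Z BZ hg hr => [|k IHk] Z BZ hg hr hk.
  apply: (len_eq0 _ _).1 => // z /hk.
  by rewrite expr0 scale1r.
(* If g^(k+1) kills Z/B, then g^k kills Y/B, while g itself kills Z/Y and can join [rest]. *)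
pose Y := sadd B (simg (scale_linear g) Z).
have YZ : Y <<= Z by apply: sadd_le => // _ [z hz ->]; apply: smodZ.
have BY : B <<= Y by apply: sadd_l.
apply: (@fin_trans _ _ Y).
  apply: IHk => //.
  - by move=> h /hg [j hj]; exists j => z /YZ; apply: hj.
  - by move=> h /hr hh z /YZ; apply: hh.
  - move=> _ [b [_ [hb [z hz ->] ->]]]; rewrite scalerDr scalerA -exprSr.
    by apply: smodD; [apply: smodZ|apply: hk].
apply: (IH (g :: rest)) => //.
- apply: sle_trans hm _; apply: shull_le => x hx; apply: shull_mem.
  by move: hx; rewrite inE !mem_cat inE orbCA.
- by move=> h /hg [j hj]; exists j => z /hj; apply: BY.
- move=> h; rewrite inE => /orP[/eqP->|/hr hh] z Zz; last by apply/BY/hh.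
  by apply: sadd_r; exists z.
Qed.

End FiniteLength.

Section Primes.
Variables (A : comNzRingType) (nA : noeth A^o).
Implicit Types (J P Q : smod A^o).

Lemma noeth_max (V : lmodType A) (X : smod V -> Prop) (J : smod V) : noeth V -> X J ->
  exists2 M, J <<= M /\ X M & forall N, M <<= N -> X N -> N <<= M.
Proof.
move=> nV XJ; apply: contrapT => hn.
pose T := {M : smod V | J <<= M /\ X M}.
have /choice [f hf] : forall M : T, exists N : T, sval M <<= sval N /\ ~ sval N <<= sval M.
  move=> [M [JM XM]] /=; apply: contrapT => h; apply: hn; exists M => // N MN XN.
  apply: contrapT => h'; apply: h.
  by exists (exist _ N (conj (sle_trans JM MN) XN)).
pose c n := iter n f (exist _ J (conj (@sle_refl _ _ J) XJ) : T).
have [|n0 h0] := @acc _ _ (fun n => sval (c n)) nV.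
  by move=> n; have [] := hf (c n).
by have [_] := hf (c n0); apply; apply: h0 n0.+1.
Qed.

Definition sprime P := ~ P 1 /\ forall x y : A, P (x * y) -> P x \/ P y.

Lemma smodM P (a x : A) : P x -> P (a * x).
Proof. exact: (@smodZ _ _ P a x). Qed.

Lemma sprimeX P (x : A) n : sprime P -> P (x ^+ n) -> P x.
Proof.
move=> [P1 hP]; elim: n => [|n IH]; first by rewrite expr0.
by rewrite exprS => /hP [//|/IH].
Qed.

(* An ideal maximal among those disjoint from a multiplicative set is prime. *)
Lemma prime_avoid J (X : A -> Prop) : X 1 -> (forall x y, X x -> X y -> X (x * y)) ->
  (forall x, J x -> ~ X x) -> exists2 P, sprime P /\ J <<= P & forall x, P x -> ~ X x.
Proof.
move=> X1 XM JX.
have [P [JP PX] maxP] := noeth_max (X := fun P => forall x, P x -> ~ X x) nA JX.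
exists P => //; split=> //; split=> [P1|x y Pxy]; first exact: PX P1 X1.
have ln (z : A) : linear (fun a : A^o => a * z : A^o).
  by move=> a b c; rewrite mulrDl /GRing.scale /= mulrA.
have key z : ~ P z -> exists2 s, X s & exists a b, P a /\ s = a + b * z.
  move=> Pz; apply: contrapT => h; apply: Pz.
  apply: (maxP (sadd P (simg (ln z) (sfull _)))).
  - exact: sadd_l.
  - move=> _ [a [_ [ha [b _ ->] ->]]] hX; apply: h.
    by exists (a + b * z) => //; exists a, b.
  - by apply: sadd_r; exists 1 => //; rewrite mul1r.
apply: contrapT => /not_orP [/key [s Xs [a [b [Pa sE]]]] /key [t Xt [c [e [Pc tE]]]]].
apply: (PX (s * t)); last exact: XM.
have -> : s * t = t * a + ((b * x) * c + (b * e) * (x * y)) by rewrite sE tE; ring.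
by apply: smodD; [|apply: smodD]; apply: smodM.
Qed.

Definition pchain n P := exists c : nat -> smod A^o,
  [/\ forall i, (i <= n)%N -> sprime (c i),
      forall i, (i < n)%N -> c i <<= c i.+1 /\ ~ c i.+1 <<= c i & c n = P].

Lemma pchain_ext n P Q : pchain n P -> P <<= Q -> ~ Q <<= P -> sprime Q ->
  pchain n.+1 Q.
Proof.
move=> [c [c1 c2 c3]] PQ nQP pQ.
exists (fun i => if (i <= n)%N then c i else Q); split=> [i|i|].
- by case: ifP => [/c1|].
- rewrite ltnS => hi; rewrite hi; case: ltnP => [/c2//|ni].
  have -> : i = n by apply/eqP; rewrite eqn_leq hi.
  by rewrite c3.
- by rewrite ltnn.
Qed.

(** Let J be generated by the first i members. As s_i is a nonzerodivisor modulo J, the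
    multiplicative set of all t s_i^n with t outside P avoids J. A prime q that contains J and
    avoids this set lies in P without s_i, hence strictly below P, and induction continues with
    q. *)
Lemma regular_chain (s : seq A) :
  (forall i, (i < size s)%N -> forall x : A,
     sspan (take i s : seq A^o) (s`_i * x) -> sspan (take i s : seq A^o) x) ->
  forall i P, (i <= size s)%N -> sprime P -> (forall j, (j < i)%N -> P s`_j) ->
  pchain i P.
Proof.
move=> reg; elim=> [|i IH] P hi pP hP; first by exists (fun=> P).
have JP : sspan (take i s : seq A^o) <<= P.
  apply: shull_le => x /(nthP 0) [j]; rewrite size_takel ?(ltnW hi) // => hj <-.
  by rewrite nth_take //; apply: hP; apply: ltnW.
have Jn n (t : A) : sspan (take i s : seq A^o) (t * s`_i ^+ n) -> P t.
  elim: n t => [|n IHn] t; first by rewrite expr0 mulr1; apply: JP.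
  by rewrite exprS mulrCA => /(reg i hi); apply: IHn.
have [||x hx [t [n [Pt xE]]]|q [pq Jq] hq] := @prime_avoid (sspan (take i s : seq A^o))
    (fun x => exists t n, ~ P t /\ x = t * s`_i ^+ n).
- by exists 1, 0%N; split; [case: pP|rewrite mulr1].
- move=> x y [t [n [Pt ->]]] [t' [n' [Pt' ->]]]; exists (t * t'), (n + n')%N; split.
    by case: pP => _ h /h [].
  by rewrite exprD; ring.
- by apply: Pt; apply: (Jn n); rewrite -xE.
have qP : q <<= P.
  move=> x qx; apply: contrapT => Px; apply: (hq x) => //.
  by exists x, 0%N; rewrite expr0 mulr1.
have nq : ~ q s`_i.
  move=> qs; apply: (hq s`_i) => //; exists 1, 1%N; rewrite mul1r expr1; split=> //.
  by case: pP.
apply: (@pchain_ext _ q) => //; last by move=> h; apply: nq; apply: h; apply: hP.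
apply: IH => // [|j hj]; first exact: ltnW.
apply: Jq; apply: shull_mem; rewrite -(nth_take _ hj); apply: mem_nth.
by rewrite size_takel // ltnW.
Qed.

End Primes.

(** * Translation from boolean submodules, and existence of parameters *)

Section Conversion.
Variable A : comNzRingType.
Implicit Types V : lmodType A.

Fact sm_of_is_smod V (S : submodClosed V) : is_smod (fun x => x \in S).
Proof. by split=> [|a x y hx hy]; rewrite ?rpred0 // rpredD ?rpredZ. Qed.
Definition sm_of V (S : submodClosed V) := Smod (sm_of_is_smod S).

Definition smodb V (T : smod V) : {pred V} := fun x => `[< T x >].
Fact smodb_closed V (T : smod V) : submod_closed (smodb T).
Proof.
split=> [|a y z /asboolP hy /asboolP hz]; apply/asboolP; first exact: smod0.
exact: smodL.
Qed.
HB.instance Definition _ V (T : smod V) := GRing.isSubmodClosed.Build A V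
  (smodb T) (GRing.submod_closed_semi (@smodb_closed V T)).
Definition sub_of V (T : smod V) : submodClosed V := smodb T.

Lemma mem_sub_of V (T : smod V) x : (x \in sub_of T) <-> T x.
Proof. by split=> /asboolP. Qed.

Lemma mem_gen V (X : set V) x : (x \in gen_submod X) <-> shull X x.
Proof.
split=> [/asboolP h S XS|h].
  by apply/mem_sub_of; apply: h => y /XS /mem_sub_of.
by apply/asboolP => S XS; apply: (h (sm_of S)).
Qed.

Lemma sm_of_gen V (X : set V) : sm_of (gen_submod X) = shull X.
Proof. by apply: smod_ext => x /mem_gen. Qed.

Lemma sm_of_smul V (J : submodClosed A^o) (S : submodClosed V) :
  sm_of (smul J S) = smulm (sm_of J) (sm_of S).
Proof. exact: sm_of_gen. Qed.

Lemma sm_of_full V : sm_of (@full_mod A V) = sfull V.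
Proof. exact: smod_ext. Qed.

Lemma sm_of_pow (I : submodClosed A^o) n : sm_of (ideal_pow I n) = ipow (sm_of I) n.
Proof.
elim: n => [|n IH]; first exact: sm_of_full.
by rewrite /= sm_of_smul IH.
Qed.

Lemma noetherianP : @noetherian A -> noeth (A^o : lmodType A).
Proof.
move=> h S; have [s hs] := h (sub_of S); exists s.
by apply: smod_ext => x; [move=> /mem_sub_of; rewrite hs => /mem_gen|
  move=> hx; apply/mem_sub_of; rewrite hs; apply/mem_gen].
Qed.

Lemma prime_sub_of (P : smod A^o) : sprime P -> prime_id (sub_of P).
Proof.
move=> [P1 hP]; split; first by apply/negP => /mem_sub_of.
by move=> x y /mem_sub_of /hP [] h; [left|right]; apply/mem_sub_of.
Qed.

Lemma pchain_strict n (P : smod A^o) : pchain n P ->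
  strict_chain [set p | exists2 J : submodClosed A^o, prime_id J & p = [set` J]] n.
Proof.
move=> [c [c1 c2 _]]; exists (fun i => [set` sub_of (c i)]); split=> i hi.
  by exists (sub_of (c i)) => //; apply: prime_sub_of; apply: c1.
have [l nl] := c2 i hi; split; first by move=> x /= /mem_sub_of /l /mem_sub_of.
by move=> h; apply: nl => x /mem_sub_of hx; apply/mem_sub_of; apply: h.
Qed.

Section Local.
Variables (m : submodClosed A^o) (hloc : noetherian_local m).

Lemma max_unit (a : A) : ~ sm_of m a -> exists c : A, sm_of m (1 - c * a).
Proof.
case: hloc => _ [m1 mm] _ ha.
have la : linear (fun c : A^o => c * a : A^o).
  by move=> b x y; rewrite mulrDl /GRing.scale /= mulrA.
pose K := sadd (sm_of m) (simg la (sfull _)).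
have := mm (sub_of K); rewrite /proper_id => H.
have mK : {subset m <= sub_of K}.
  by move=> x hx; apply/mem_sub_of; apply: sadd_l.
have [/mem_sub_of|n1] := boolP ((1 : A^o) \in sub_of K).
  by move=> [b [_ [hb [c _ ->] E]]]; exists c; rewrite E addrK.
exfalso; apply: ha; rewrite /= -(H mK n1); apply/mem_sub_of.
by apply: sadd_r; exists 1 => //; rewrite mul1r.
Qed.

Lemma proper_le_max (P : smod A^o) : ~ P 1 -> P <<= sm_of m.
Proof.
case: hloc => nA _ mu P1.
have [M [PM M1] maxM] := noeth_max (X := fun P : smod A^o => ~ P 1) (noetherianP nA) P1.
apply: sle_trans PM _ => x Mx; rewrite /= -(mu (sub_of M)); first exact/mem_sub_of.
split; first by apply/negP => /mem_sub_of.
move=> K MK K1 y; apply/idP/idP => hy; last exact: MK.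
apply/mem_sub_of; apply: (maxM (sm_of K)) => //.
  by move=> z /mem_sub_of /MK.
by move=> K1'; move: K1; rewrite /proper_id => /negP.
Qed.

End Local.

(** Take powers in I of a regular sequence of length d in m. If no power of some g in m fell into
    the ideal they generate, a prime P would contain the sequence but not g; [regular_chain] would
    give a chain of length d ending at P, and m would prolong it beyond the dimension. *)
Theorem parameters_exist (m I : submodClosed A^o) d : noetherian_local m ->
  krull_dim A d -> cohen_macaulay m -> primary_to m I ->
  exists ys : seq A, [/\ size ys = d, sspan (ys : seq A^o) <<= sm_of I &
    forall g : A, sm_of m g -> exists k, sspan (ys : seq A^o) (g ^+ k)].
Proof.
move=> hloc [kd1 kd2] [_ [d' [kd1' kd2'] [[s [sm sd] [reg _]] _]]] [_ radI].
have dd : d' = d by apply/eqP; rewrite eqn_leq kd2 // kd2'.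
move: sd; rewrite dd => sd; have [nA [m1 _] _] := hloc; have {}nA := noetherianP nA.
have /choice [N hN] : forall x : A, exists n, sm_of m x -> sm_of I (x ^+ n).
  move=> x; have [mx|] := pselect (sm_of m x); last by exists 0%N.
  have : radical I x by rewrite radI.
  by case=> n hn; exists n.
pose ys := [seq x ^+ N x | x <- s].
exists ys; split; first by rewrite size_map.
  apply: shull_le => _ /mapP [x xs ->]; apply: hN; exact: sm.
move=> g mg; apply: contrapT => hg.
have [||x hx [k xE]|P [pP QP] hP] := @prime_avoid _ nA (sspan (ys : seq A^o))
  (fun x => exists k, x = g ^+ k).
- by exists 0%N.
- by move=> x y [k ->] [l ->]; exists (k + l)%N; rewrite exprD.
- by apply: hg; exists k; rewrite -xE.
have sP x : x \in s -> P x.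
  move=> xs; apply: (sprimeX (n := N x)) => //; apply: QP; apply: shull_mem.
  by apply: map_f.
have Pg : ~ P g by move=> /hP; apply; exists 1%N.
have Pm : P <<= sm_of m by apply: (proper_le_max hloc); case: pP.
have pm : sprime (sm_of m).
  split=> [|x y hxy]; first exact/negP.
  apply: contrapT => /not_orP [/(max_unit hloc) [a ha] /(max_unit hloc) [b hb]].
  move/negP: m1; apply.
  suff : sm_of m 1 by [].
  have -> : 1 = (1 - a * x) + (a * x) * (1 - b * y) + (a * b) * (x * y) by ring.
  by apply: smodD; [apply: smodD => //|]; apply: smodM.
have ch : pchain d P.
  rewrite -sd; apply: (regular_chain nA) => //; last by move=> j hj; apply/sP/mem_nth.
  move=> i hi x hx.
  (* [regular_seq] speaks of the product of the ideal with the whole module, which over [A] itself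
     is the ideal. *)
  have E : sm_of (smul (gen_submod [set` take i s : seq A^o]) (@full_mod A A^o)) =
      sspan (take i s : seq A^o).
    rewrite sm_of_smul sm_of_full sm_of_gen; apply: smod_ext.
      apply: smulm_le => a y ha _; have -> : a *: y = (y : A) *: (a : A^o) by exact: (@mulrC A).
      exact: smodZ.
    move=> y hy; rewrite -[y]mulr1; exact: (smulm_mem hy).
  rewrite -E; apply: (reg i hi x).
  suff : sm_of (smul (gen_submod [set` take i s : seq A^o]) (@full_mod A A^o))
    (s`_i * x) by [].
  by rewrite E.
have nm : ~ sm_of m <<= P by move=> /(_ g mg).
by have := kd2 _ (pchain_strict (pchain_ext ch Pm nm pm)); rewrite ltnn.
Qed.

End Conversion.

(** * Presentations and Tor *)

Section Presentations.
Variable A : comNzRingType.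
Implicit Types U V W P : lmodType A.

Definition sker V W (f : V -> W) (hf : linear f) : smod V := spre hf (szero W).

(** [f] has to reach only the image of [g], so that lifting into the source of a map that is not
    surjective needs no corestriction. *)
Definition projective P := forall V W (f : V -> W) (g : P -> W), linear f -> linear g ->
  (forall x, exists v, f v = g x) -> exists2 h : P -> V, linear h & forall x, f (h x) = g x.

Lemma smod_sum V (S : smod V) (I : Type) (r : seq I) (F : I -> V) :
  (forall i, S (F i)) -> S (\sum_(i <- r) F i).
Proof.
by move=> h; elim: r => [|i r IH]; rewrite ?big_nil ?big_cons; [exact: smod0|exact: smodD].
Qed.

Lemma linear_comp U V W (f : V -> W) (g : U -> V) : linear f -> linear g -> linear (f \o g).
Proof. by move=> hf hg a x y /=; rewrite hg hf. Qed.

Lemma free_ind (X : choiceType) (S : smod (free_mod A X)) :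
  (forall x, S (free_gen A x)) -> forall f, S f.
Proof.
move=> h f; have /asboolP ff := valP f.
pose D := fset_set [set x | free_coef f x != 0].
suff -> : f = \sum_(x <- D) free_coef f x *: free_gen A x.
  by apply: smod_sum => x; apply: smodZ.
have cf0 y : free_coef (0 : free_mod A X) y = 0.
  by have := free_coefP 0 (0 : free_mod A X) 0 y; rewrite scale0r addr0 mul0r add0r.
have cf (r : seq X) y : free_coef (\sum_(x <- r) free_coef f x *: free_gen A x) y =
    \sum_(x <- r) free_coef f x * (x == y)%:R.
  elim: r => [|x r IH]; first by rewrite !big_nil.
  by rewrite !big_cons free_coefP IH.
apply: val_inj; apply/funext => y; apply: etrans (esym (cf _ _)).
rewrite -/(free_coef f y); have [yD|yD] := boolP (y \in D).
  rewrite (big_fsetD1 y) //= eqxx mulr1 big1_fset ?addr0 // => x.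
  by rewrite !inE => /andP[/negPf -> _] _; rewrite mulr0.
have -> : free_coef f y = 0.
  by apply/eqP; apply: contraNT yD => hy; rewrite in_fset_set // inE.
rewrite big1_fset // => x xD _; have [xy|] := eqVneq x y; last by rewrite mulr0.
by move: yD; rewrite -xy xD.
Qed.

Lemma projective_free (X : choiceType) : projective (free_mod A X).
Proof.
move=> V W f g hf hg hs.
have /choice [h0 hh] : forall x : X, exists v, f v = g (free_gen A x) by [].
exists (free_lift h0); first by move=> a x y; rewrite linearP.
have lc : linear (f \o free_lift h0).
  by move=> a x y; rewrite /= linearP hf.
have P : is_smod (fun u => f (free_lift h0 u) = g u).
  split=> [|a x y hx hy]; first by rewrite linear0 (linear_0 hf) (linear_0 hg).
  by rewrite linearP hf hg hx hy.
by apply: (free_ind (S := Smod P)) => x /=; rewrite free_lift_gen.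
Qed.

Lemma projective_regular : projective A^o.
Proof.
move=> V W f g hf hg hs; have [v hv] := hs 1.
exists (fun a : A^o => (a : A) *: v) => [a x y|x].
  by rewrite scalerDl scalerA.
by rewrite (linear_Z _ _ hf) hv -(linear_Z _ _ hg) [_ *: _]mulr1.
Qed.

Lemma pair_l_linear U V : linear (fun x : U => (x, 0) : (U * V)%type).
Proof.
by move=> a x y; congr pair; apply: esym; apply: etrans (addr0 _) (scaler0 _ _).
Qed.

Lemma pair_r_linear U V : linear (fun y : V => (0, y) : (U * V)%type).
Proof.
by move=> a x y; congr pair; apply: esym; apply: etrans (addr0 _) (scaler0 _ _).
Qed.

Lemma fst_linear U V : linear (fun x : (U * V)%type => x.1). Proof. by []. Qed.
Lemma snd_linear U V : linear (fun x : (U * V)%type => x.2). Proof. by []. Qed.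

Lemma projective_prod U V : projective U -> projective V -> projective (U * V)%type.
Proof.
move=> pU pV X Y f g hf hg hs.
have [h1 l1 e1] := pU _ _ _ _ hf (linear_comp hg (@pair_l_linear U V)) (fun x => hs _).
have [h2 l2 e2] := pV _ _ _ _ hf (linear_comp hg (@pair_r_linear U V)) (fun x => hs _).
exists (fun x => h1 x.1 + h2 x.2) => [a x y|[x y]].
  by rewrite l1 l2 scalerDr addrACA.
rewrite (linear_D _ _ hf) e1 e2 /= -(linear_D _ _ hg); congr g.
by congr pair; rewrite ?addr0 ?add0r.
Qed.

Lemma noeth_prod U V : noeth U -> noeth V -> noeth (U * V)%type.
Proof.
move=> nU nV S.
have [s hs] := nU (spre (@pair_l_linear U V) S).
have [t ht] := nV (simg (@snd_linear U V) S).
have /choice [f hf] : forall y, exists x, y \in t -> S (x, y).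
  move=> y; have [yt|] := boolP (y \in t); last by exists 0.
  have : sspan t y by apply: shull_mem.
  by rewrite -ht => -[[x y'] /= hx ->]; exists x.
exists ([seq (x, 0) | x <- s] ++ [seq (f y, y) | y <- t]).
set r := _ ++ _.
have rS : sspan r <<= S.
  apply: shull_le => z; rewrite mem_cat => /orP[/mapP[x xs ->]|/mapP[y yt ->]].
    suff : spre (@pair_l_linear U V) S x by [].
    by rewrite hs; apply: shull_mem.
  exact: hf.
apply: (smod_ext _ rS) => -[x y] hxy.
have [z hz] : exists z, sspan r (z, y).
  have : sspan t y by rewrite -ht; exists (x, y).
  suff : sspan t <<= simg (@snd_linear U V) (sspan r).
    by move=> h /h [[z y'] /= hz ->]; exists z.
  apply: shull_le => w wt; exists (f w, w) => //; apply: shull_mem.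
  by rewrite mem_cat; apply/orP; right; apply: map_f.
have -> : (x, y) = (x - z, 0) + (z, y) by congr pair; rewrite ?subrK ?add0r.
apply: smodD => //.
have : spre (@pair_l_linear U V) S (x - z).
  have -> : x - z = ((x, y) - (z, y)).1 by [].
  rewrite /spre /=; suff -> : (x - z, 0) = (x, y) - (z, y) by apply: smodB => //; apply: rS.
  by congr pair; rewrite subrr.
rewrite hs; suff : sspan s <<= spre (@pair_l_linear U V) (sspan r) by apply.
apply: shull_le => w ws; apply: shull_mem.
by rewrite mem_cat; apply/orP; left; apply: map_f.
Qed.

(** [P] is a finite power of [A], built one factor for each generator; it is noetherian, unlike the
    free module on the set [V] in general. *)
Lemma presentation V (s : seq V) : noeth A^o -> exists P, exists pi : P -> V,
  [/\ linear pi, projective P, noeth P & forall x, sspan s x -> exists y, pi y = x].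
Proof.
move=> nA; elim: s => [|x s [P [pi [lpi pP nP hpi]]]].
  exists A^o, (fun=> 0); split=> //.
  - by move=> a x y; rewrite scaler0 addr0.
  - exact: projective_regular.
  - move=> x hx; exists 0; apply: esym; apply: (hx (szero V)).
    by move=> y; rewrite in_nil.
exists (A^o * P)%type, (fun z => (z.1 : A) *: x + pi z.2).
have lpi' : linear (fun z : (A^o * P)%type => (z.1 : A) *: x + pi z.2).
  by move=> a z w; rewrite lpi scalerDl scalerDr scalerA addrACA.
split=> //.
- exact: (projective_prod projective_regular pP).
- exact: noeth_prod.
- move=> y hy; suff : simg lpi' (sfull _) y by case=> z _ ->; exists z.
  apply: hy => z; rewrite inE => /orP[/eqP ->|zs].
    by exists (1, 0); rewrite //= scale1r (linear_0 lpi) addr0.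
  have [w hw] : exists w, pi w = z by apply: hpi; apply: shull_mem.
  by exists (0, w); rewrite //= scale0r add0r.
Qed.

(* Tor_1(V, A/J) is (K \cap J P) / J K for a presentation with kernel K. *)
Definition tor_bot P V (pi : P -> V) (hpi : linear pi) J := smulm J (sker hpi).
Definition tor_top P V (pi : P -> V) (hpi : linear pi) J :=
  scap (sker hpi) (smulm J (sfull P)).

Lemma tor_le P V (pi : P -> V) (hpi : linear pi) J : tor_bot hpi J <<= tor_top hpi J.
Proof. by move=> x hx; split; [apply: smulm_sub hx|apply: smulm_mono x hx]. Qed.

Section Compare.
Variables (P P' V : lmodType A) (pi : P -> V) (pi' : P' -> V).
Hypotheses (hpi : linear pi) (hpi' : linear pi').
Hypotheses (pP : projective P) (pP' : projective P').
Hypotheses (spi : forall v, exists x, pi x = v) (spi' : forall v, exists x, pi' x = v).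

(** [phi] and [psi] lift the identity of [V] in both directions. As y - psi (phi y) always lies in
    the kernel K of [pi], the map y |-> y - psi (phi y) carries J P into J K; hence [phi] is
    injective on Tor. *)
Lemma tor_compare J : fin (tor_bot hpi' J) (tor_top hpi' J) ->
  fin (tor_bot hpi J) (tor_top hpi J) /\
  (len (tor_bot hpi J) (tor_top hpi J) <= len (tor_bot hpi' J) (tor_top hpi' J))%N.
Proof.
have [phi lphi ephi] := pP hpi' hpi (fun x => spi' (pi x)).
have [psi lpsi epsi] := pP' hpi hpi' (fun x => spi (pi' x)).
apply: (len_inj lphi).
- exact: tor_le.
- exact: tor_le.
- move=> x [hx hJ]; split; first by rewrite /sker /= ephi.
  by apply: (smulm_mono _ _ (smulm_img lphi hJ)).
move=> x [hx hJ] hphi.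
have h1 : smulm J (sker hpi) (psi (phi x)).
  apply: (smulm_mono _ _ (smulm_img lpsi hphi)) => // _ [y hy ->].
  by rewrite /sker /= epsi.
apply: (smodBD (y := psi (phi x))) => //.
have l : linear (fun y => y - psi (phi y)).
  move=> a y z; rewrite lphi lpsi scalerBr opprD addrACA //.
apply: (smulm_mono _ _ (smulm_img l hJ)) => // _ [y _ ->].
by rewrite /sker /= (linear_B _ _ hpi) epsi ephi subrr.
Qed.

End Compare.

Lemma tor_compare_eq P P' V (pi : P -> V) (pi' : P' -> V)
  (hpi : linear pi) (hpi' : linear pi') J : projective P -> projective P' ->
  (forall v, exists x, pi x = v) -> (forall v, exists x, pi' x = v) ->
  fin (tor_bot hpi' J) (tor_top hpi' J) ->
  fin (tor_bot hpi J) (tor_top hpi J) /\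
  len (tor_bot hpi J) (tor_top hpi J) = len (tor_bot hpi' J) (tor_top hpi' J).
Proof.
move=> pP pP' s s' f'; have [f l] := tor_compare hpi pP pP' s s' f'.
have [_ l'] := tor_compare hpi' pP' pP s' s f.
by split=> //; apply/eqP; rewrite eqn_leq l l'.
Qed.

End Presentations.

(** * Length of the Tor_1 of the standard resolution *)

Section Tor.
Variable A : comNzRingType.
Implicit Types U V W M N : lmodType A.

Lemma chain_strict V n : chain (szero V) (sfull V) n <->
  strict_chain [set p | exists S : submodClosed V, p = [set` S]] n.
Proof.
split=> [[c [_ c2]]|[c [c1 c2]]].
  exists (fun i => [set` sub_of (c i)]); split=> i hi; first by exists (sub_of (c i)).
  have [l nl] := c2 i hi; split; first by move=> x /= /mem_sub_of /l /mem_sub_of.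
  by move=> h; apply: nl => x /mem_sub_of hx; apply/mem_sub_of; apply: h.
have /choice [S hS] : forall i, exists S : smod V, (i <= n)%N -> c i = (S : set V).
  move=> i; have [/c1 [S ->]|] := boolP (i <= n)%N; last by exists (szero V).
  by exists (sm_of S).
exists S; split=> i hi; first by split=> // x ->; exact: smod0.
by have [l nl] := c2 i hi; move: l nl; rewrite !hS ?(ltnW hi).
Qed.

Lemma mod_lengthE V : mod_length V = len (szero V) (sfull V).
Proof.
rewrite /mod_length /len; congr xget; apply/seteqP.
by split=> n [h1 h2]; split; do ?[exact/chain_strict]; move=> k /chain_strict /h2.
Qed.

Lemma length_subquot V (Z B : submodClosed V) : fin (sm_of B) (sm_of Z) ->
  mod_length (subquot Z B) = len (sm_of B) (sm_of Z).
Proof.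
move=> f; have [BZ _] := f; rewrite mod_lengthE.
have lv : linear (val : submod Z -> V) by exact: submod_val_is_linear.
have lq : linear (qproj (@trace_submod A V Z B)) by move=> a x y; rewrite linearP.
have [//|//|x _|x _|y hy||f1 _ <-] := @len_iso _ _ _ _ lv (spre lv (sm_of B)) (sfull _)
    (sm_of B) (sm_of Z).
- by [].
- exact: (valP x).
- by exists (exist _ y hy) => //; rewrite subrr; exact: smod0.
- by right.
have [//|//|x _|//|y _||_ _ <-] := @len_iso _ _ _ _ lq (spre lv (sm_of B)) (sfull _)
    (szero _) (sfull _).
- by split=> [hx|/eqP]; [apply/eqP|]; rewrite qproj_eq0.
- by have [x <-] := qproj_surj y; exists x => //; rewrite subrr.
- by left.
- by [].
Qed.

Section TensorQuotient.
Variable J : submodClosed A^o.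
Local Notation Q := (quotmod J : lmodType A).
Local Notation one := (qproj J (1 : A^o) : Q).

Definition tens M N (x : M) (y : N) : tensor M N := tensor_proj (free_gen A (x, y)).

Lemma tensor_proj0 M N w : w \in gen_submod (@tensor_rel A M N) ->
  @tensor_proj A M N w = 0.
Proof. by move=> h; apply/eqP; rewrite /tensor_proj qproj_eq0. Qed.

Lemma tens_linear_l M N (y : N) : linear (fun x : M => tens x y).
Proof.
move=> a x x'; apply/eqP; rewrite -subr_eq0 /tens -linearP -linearB; apply/eqP.
apply: tensor_proj0; apply/mem_gen; apply: shull_mem; left.
by exists a, x, x', y; rewrite opprD addrA.
Qed.

Lemma tens_linear_r M N (x : M) : linear (fun y : N => tens x y).
Proof.
move=> a y y'; apply/eqP; rewrite -subr_eq0 /tens -linearP -linearB; apply/eqP.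
apply: tensor_proj0; apply/mem_gen; apply: shull_mem; right.
by exists a, x, y, y'; rewrite opprD addrA.
Qed.

Lemma tens_surj M (t : tensor M Q) : exists u, tens u one = t.
Proof.
have [w <-] := qproj_surj t.
have lp : linear (@tensor_proj A M Q) by move=> a x y; rewrite linearP.
suff : spre lp (simg (@tens_linear_l M Q one) (sfull M)) w.
  by case=> u _ e; exists u; rewrite -e.
apply: free_ind => -[u q] /=; have [a <-] := qproj_surj q.
exists (a *: u) => //; rewrite (linear_Z _ _ (@tens_linear_l M Q one)).
rewrite -(linear_Z _ _ (@tens_linear_r M Q u)) -/(tens u _); congr tens.
by rewrite -linearZ /= [_ *: _]mulr1.
Qed.

Lemma tensor_map_tens M M' (f : {linear M -> M'}) (u : M) (q : Q) :
  tensor_map Q f (tens u q) = tens (f u) q.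
Proof.
rewrite /tens -[tensor_map _ _ _]/(tensor_map Q f (tensor_proj _)) tensor_mapE.
by rewrite /tensor_map_free /= free_lift_gen.
Qed.

Lemma tensor_dE M (y : free_mod A (syz M)) :
  tensor_d M Q (tens y one) = tens (res_d y) one.
Proof. exact: tensor_map_tens. Qed.

(** This identifies the tensor product of U and A/J with U/JU. *)
Lemma tens_eq0 U (v : U) : tens v one = 0 <-> smulm (sm_of J) (sfull U) v.
Proof.
split; last first.
  suff : smulm (sm_of J) (sfull U) <<= sker (@tens_linear_l U Q one) by apply.
  apply: smulm_le => a x ha _; rewrite /sker /= (linear_Z _ _ (@tens_linear_l U Q one)).
  rewrite -(linear_Z _ _ (@tens_linear_r U Q x)).
  have -> : a *: one = 0 :> Q.
    by rewrite -linearZ /=; apply/eqP; rewrite qproj_eq0 [_ *: _]mulr1.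
  exact: (linear_0 (@tens_linear_r U Q x)).
move=> /eqP; rewrite /tens /tensor_proj qproj_eq0 => /mem_gen h.
pose JU := smulm (sm_of J) (sfull U).
pose rp (q : Q) : A := repr (q : {ideal_quot (zmod_of J)}).
have rpE q : qproj J (rp q) = q by rewrite /qproj /rp reprK.
have rpJ (a b : A^o) : qproj J a = qproj J b -> (a - b) \in J.
  by move=> e; rewrite -qproj_eq e.
(* The inverse map to U/JU uses chosen representatives of A/J. They are linear only modulo J, which
   is enough to kill the tensor relations. *)
pose L := free_lift (fun p : U * Q => qproj (sub_of JU) (rp p.2 *: p.1)).
have lL : linear L by move=> a x y; rewrite /L linearP.
have JUm (a : A^o) x : a \in J -> (a : A) *: (x : U) \in sub_of JU.
  by move=> ha; apply/mem_sub_of; apply: smulm_mem.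
have : sker lL (free_gen A (v, one)).
  apply: h => _ [[a [x [x' [q ->]]]]|[a [x [q [q' ->]]]]]; rewrite /sker /=.
    rewrite !(linear_B _ _ lL) (linear_Z _ _ lL) /L !free_lift_gen /=.
    by rewrite scalerDr scalerA mulrC -scalerA linearP /= addrAC addrK subrr.
  rewrite !(linear_B _ _ lL) (linear_Z _ _ lL) /L !free_lift_gen /=.
  rewrite -linearZ -!linearB; apply/eqP; rewrite qproj_eq0.
  rewrite scalerA -!scalerBl; apply: JUm; rewrite -addrA -opprD.
  apply: rpJ; apply: etrans (rpE _) _.
  have -> : (a * rp q + rp q' : A^o) = (a : A) *: (rp q : A^o) + (rp q' : A^o) by [].
  by rewrite linearP /= !rpE.
rewrite /sker /= /L free_lift_gen => /eqP; rewrite qproj_eq0 => /mem_sub_of /= h'.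
have -> : v = rp one *: v - (rp one - 1) *: v by rewrite -scalerBl subKr scale1r.
apply: (@smodB _ _ JU) => //.
by apply: (smulm_mem (J := sm_of J)) => //; apply: rpJ; rewrite rpE.
Qed.

Lemma augm_surj M (x : M) : exists u, augm u = x.
Proof. by exists (free_gen A x); rewrite /augm free_lift_gen. Qed.

Lemma augm_linear M : linear (@augm A M). Proof. by move=> a x y; rewrite linearP. Qed.
Lemma res_d_linear M : linear (@res_d A M). Proof. by move=> a x y; rewrite linearP. Qed.

Lemma res_d_exact M u : augm u = 0 <-> exists y, res_d y = u :> free_mod A M.
Proof.
split=> [/eqP h|[y <-]].
  have [y hy] := augm_surj (exist _ u h : syz M).
  by exists y; rewrite /res_d /= hy.
rewrite /res_d /=; apply/eqP; exact: (valP (augm y)).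
Qed.

Lemma res_d_eq0 M y : res_d y = 0 :> free_mod A M <-> augm y = 0.
Proof.
split=> [|h]; last by rewrite /res_d /= h linear0.
move=> h; apply: val_inj; exact: h.
Qed.

(** Write F1 for F(syz M) and K for the kernel of [augm]. With F1 tensored by A/J read as F1/J F1,
    cycles are the y with d y in J F(M), and boundaries are those with d y in J K. So d carries the
    homology onto (K \cap J F(M)) / J K. *)
Theorem length_Tor1 M :
  fin (tor_bot (@augm_linear M) (sm_of J)) (tor_top (@augm_linear M) (sm_of J)) ->
  mod_length (Tor1 M Q) =
  len (tor_bot (@augm_linear M) (sm_of J)) (tor_top (@augm_linear M) (sm_of J)).
Proof.
move=> f; set B' := tor_bot _ _ in f *; set Z' := tor_top _ _ in f *.
have kerE : sker (@augm_linear M) = simg (@res_d_linear M) (sfull _).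
  by apply: smod_ext => x; [move/res_d_exact => [y <-]; exists y|
    case=> y _ ->; apply/res_d_exact; exists y].
have [|//|//|x hx|y [hy1 hy2]||f1 _ <-] := @len_iso _ _ _ _ (@res_d_linear M)
    (spre (@res_d_linear M) B') (spre (@res_d_linear M) Z') B' Z'.
- by move=> x; apply: tor_le.
- exact: tor_le.
- by [].
- move: hy1 hy2; rewrite kerE => -[x _ ->] hx; exists x; last by rewrite subrr; exact: smod0.
  by split=> //; rewrite kerE; exists x.
- by right.
have lt := @tens_linear_l (free_mod A (syz M)) Q one.
have ZE y : tens y one \in ker_mod (tensor_d M Q) <-> spre (@res_d_linear M) Z' y.
  have -> : (tens y one \in ker_mod (tensor_d M Q)) =
      (tensor_d M Q (tens y one) == 0) by [].
  rewrite tensor_dE; split=> [/eqP/tens_eq0 h|[_ h]].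
    by split=> //; rewrite kerE; exists y.
  by apply/eqP/tens_eq0.
(* A boundary is d u plus an element of J F1; d kills the first and maps J F1 onto J K. Conversely,
   elements of F1 with the same image under d differ by some d u. *)
have BE y : tens y one \in im_mod (tensor_d (syz M) Q) <-> spre (@res_d_linear M) B' y.
  split=> [/asboolP [t]|].
    have [u <-] := tens_surj t; rewrite tensor_dE => e.
    have /tens_eq0 h : tens (y - res_d u) one = 0 by rewrite (linear_B _ _ lt) e subrr.
    have /(smulm_img (@res_d_linear M)) : smulm (sm_of J) (sfull _) (y - res_d u) by [].
    rewrite -kerE linearB /= (_ : res_d (res_d u) = 0) ?subr0 //.
    by apply/res_d_eq0; apply/res_d_exact; exists u.
  move=> hy; have {hy} : B' (res_d y) by [].
  rewrite /B' /tor_bot kerE -simg_smulm => -[h hJ e].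
  have /res_d_eq0/res_d_exact [u hu] : res_d (y - h) = 0 :> free_mod A M.
    by rewrite linearB /= e subrr.
  apply/asboolP; exists (tens u one); rewrite tensor_dE hu.
  have /tens_eq0 : smulm (sm_of J) (sfull _) h by [].
  by rewrite (linear_B _ _ lt) => ->; rewrite subr0.
have [x hx|t ht|x hx|x hx|t ht||f2 f3 ->] := @len_iso _ _ _ _ lt
    (spre (@res_d_linear M) B') (spre (@res_d_linear M) Z')
    (sm_of (im_mod (tensor_d (syz M) Q))) (sm_of (ker_mod (tensor_d M Q))).
- exact: tor_le.
- have [y e] := tens_surj t; move: ht; rewrite -e => /BE h; apply/ZE; exact: tor_le.
- by split=> /BE.
- exact/ZE.
- have [y e] := tens_surj t; move: ht; rewrite -e => /ZE h; exists y => //.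
  by rewrite subrr; exact: smod0.
- by left.
- exact: length_subquot.
Qed.

End TensorQuotient.
End Tor.

(** * Extensions *)

Section Defect.
Variables (A : comNzRingType) (M N : lmodType A) (J : smod A^o).
Local Notation FM := (free_mod A M).
Local Notation FN := (free_mod A N).
Local Notation FE := (FN * FM)%type.
Local Notation KM := (sker (@augm_linear A M)).
Local Notation KN := (sker (@augm_linear A N)).
Implicit Types z : free_mod A (syz M) -> N.

(* The kernel of F(N) x F(M) -> E when E is the extension with cocycle z. *)
Fact ext_ker_is_smod z (hz : linear z) :
  is_smod (fun p : FE => exists2 y, res_d y = p.2 & augm p.1 = z y).
Proof.
split=> [|a p q [y hy e] [y' hy' e']].
  exists 0; first exact: linear0.
  by apply: etrans (linear0 _) (esym (linear_0 hz)).
exists (a *: y + y'); first by rewrite res_d_linear hy hy'.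
by rewrite hz -e -e' -augm_linear.
Qed.
Definition ext_ker z (hz : linear z) := Smod (ext_ker_is_smod hz).

(** The connecting map sends the class of d y, for d y in J F(M), to z y modulo J N. *)
Definition def_top z (hz : linear z) : smod N :=
  sadd (smulm J (sfull N)) (simg hz (spre (@res_d_linear A M) (smulm J (sfull FM)))).

(** Modulo J KN this is the kernel of Tor_1(N, A/J) -> Tor_1(E, A/J), which by exactness is the
    image of Tor_2(M, A/J). *)
Definition def_bot z (hz : linear z) : smod FN :=
  spre (@pair_l_linear A FN FM) (smulm J (ext_ker hz)).

(* The lengths of the images of Tor_1(M, A/J) in N/JN and of Tor_2(M, A/J) in
   Tor_1(N, A/J) under the connecting maps. *)
Definition defect z (hz : linear z) : nat :=
  (len (smulm J (sfull N)) (def_top hz) + len (smulm J KN) (def_bot hz))%N.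

Lemma res_d_ker y : KM (res_d y).
Proof. by apply/res_d_exact; exists y. Qed.

Section OneCocycle.
Variables (z : free_mod A (syz M) -> N) (hz : linear z).
Hypothesis cz : forall u, z (res_d u) = 0.

Lemma cocycle_eq y y' : res_d y = res_d y' :> FM -> z y = z y'.
Proof.
move=> e; have /res_d_eq0/res_d_exact [u hu] : res_d (y - y') = 0 :> FM.
  by rewrite linearB /= e subrr.
by apply/eqP; rewrite -subr_eq0 -(linear_B _ _ hz) -hu cz.
Qed.

Lemma snd_ext_ker : simg (@snd_linear A FN FM) (ext_ker hz) = KM.
Proof.
apply: smod_ext => [_ [p [y e _] ->]|b /res_d_exact [y <-]].
  by rewrite -e; apply: res_d_ker.
by have [a ha] := augm_surj (z y); exists (a, res_d y) => //; exists y.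
Qed.

Hypothesis finM : fin (tor_bot (@augm_linear A M) J) (tor_top (@augm_linear A M) J).
Hypothesis finN : fin (tor_bot (@augm_linear A N) J) (tor_top (@augm_linear A N) J).

(** X/Y is Tor_1(E, A/J). [X0] and [XM] give the kernel and the image of its map to Tor_1(M, A/J);
    the kernel X0/Y is also the image of Tor_1(N, A/J). *)
Let Y := smulm J (ext_ker hz).
Let X := scap (ext_ker hz) (smulm J (sfull FE)).
Let X0 := sadd Y (scap X (spre (@snd_linear A FN FM) (szero FM))).
Let XM := simg (@snd_linear A FN FM) X.

Lemma ext_bot_le : Y <<= X.
Proof. by move=> p hp; split; [apply: smulm_sub hp|apply: smulm_mono p hp]. Qed.

Lemma def_bot_ge : smulm J KN <<= def_bot hz.
Proof.
move=> a /(smulm_img (@pair_l_linear A FN FM)); apply: smulm_mono => // _ [b hb ->].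
by exists 0; rewrite /= ?linear0 ?(linear_0 hz).
Qed.

Lemma ext_top_tor a : X (a, 0) -> tor_top (@augm_linear A N) J a.
Proof.
move=> [[y hy e] hJ]; have h := smulm_img (@fst_linear A FN FM) hJ; split.
  by rewrite /sker /= e (@cocycle_eq y 0) ?linear0 ?(linear_0 hz).
by apply: (smulm_mono _ _ h).
Qed.

Lemma def_bot_le : def_bot hz <<= tor_top (@augm_linear A N) J.
Proof. by move=> a ha; apply: ext_top_tor; apply: ext_bot_le. Qed.

(** Exactness at Tor_1(M, A/J): modulo the image of Tor_1(E, A/J), the connecting map embeds it into
    N/JN. If z y lies in J N, it is the augmentation of some a in J F(N), and (a, d y) is the lift
    to [X]. *)
Lemma tor_M_split : [/\ fin (tor_bot (@augm_linear A M) J) XM,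
  fin (smulm J (sfull N)) (def_top hz) &
  len (tor_bot (@augm_linear A M) J) (tor_top (@augm_linear A M) J) =
  (len (tor_bot (@augm_linear A M) J) XM + len (smulm J (sfull N)) (def_top hz))%N].
Proof.
have l1 : tor_bot (@augm_linear A M) J <<= XM.
  move=> b; rewrite /tor_bot -snd_ext_ker -simg_smulm => -[p hp ->].
  by exists p => //; apply: ext_bot_le.
have l2 : XM <<= tor_top (@augm_linear A M) J.
  move=> _ [p [hp hJ] ->]; split.
    by rewrite -snd_ext_ker; exists p.
  by apply: (smulm_mono _ _ (smulm_img (@snd_linear A FN FM) hJ)).
have [f1 f2 ->] := len_split l1 l2 finM.
pose Z := spre (@res_d_linear A M) (tor_top (@augm_linear A M) J).
have lZ : spre (@res_d_linear A M) XM <<= Z by move=> y; apply: l2.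
have [||b hb||g1 _ <-] := len_iso (@res_d_linear A M) lZ l2.
- by [].
- by [].
- have [/res_d_exact [y e] _] := hb; exists y; first by rewrite /Z /= e.
  by rewrite e subrr; exact: smod0.
- by right.
have lN : smulm J (sfull N) <<= def_top hz by exact: sadd_l.
have [y [hy1 hy2]|y [_ hy]|w||_ g2 ->] := len_iso hz lZ lN.
- split=> [[[a b] [[y' e' ea] hJ] e]|hw].
    rewrite /= in e' ea e.
    rewrite (@cocycle_eq y y') ?e ?e' // -ea.
    have h1 := smulm_img (@fst_linear A FN FM) hJ.
    by apply: (smulm_mono _ _ (smulm_img (@augm_linear A N) h1)).
  have [a ha hae] : simg (@augm_linear A N) (smulm J (sfull FN)) (z y).
    rewrite simg_smulm; apply: (smulm_mono _ _ hw) => // n _.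
    by have [a <-] := augm_surj n; exists a.
  exists (a, res_d y) => //; split; first by exists y.
  have -> : (a, res_d y) = (a, 0) + (0, res_d y) :> FE.
    by congr pair; rewrite ?addr0 ?add0r.
  apply: smodD.
    by apply: (smulm_mono _ _ (smulm_img (@pair_l_linear A FN FM) ha)).
  by apply: (smulm_mono _ _ (smulm_img (@pair_r_linear A FN FM) hy2)).
- by apply: sadd_r; exists y.
- move=> [n [_ [hn [y hy ->] ->]]]; exists y; last by rewrite addrK.
  by split=> //; apply: res_d_ker.
- by left.
by split.
Qed.

Lemma tor_N_split : [/\ fin (smulm J KN) (def_bot hz), fin Y X0 &
  len (tor_bot (@augm_linear A N) J) (tor_top (@augm_linear A N) J) =
  (len (smulm J KN) (def_bot hz) + len Y X0)%N].
Proof.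
have [f1 f2 ->] := len_split def_bot_ge def_bot_le finN.
have lY : Y <<= X0 by exact: sadd_l.
have [a _|a [ha hJ]|p||_ f3 ->] := len_iso (@pair_l_linear A FN FM) def_bot_le lY.
- by [].
- apply: sadd_r; split=> //; split; first by exists 0; rewrite /= ?linear0 ?(linear_0 hz).
  by apply: (smulm_mono _ _ (smulm_img (@pair_l_linear A FN FM) hJ)).
- move=> [y [[a b] [hy [hab /= e] ->]]]; move: hab; rewrite e => hab.
  by exists a; [apply: ext_top_tor|rewrite addrK].
- by left.
by split.
Qed.

(** The outer two sequences are cut at the kernel X0/Y and the image of Tor_1(E, A/J) -> Tor_1(M,
    A/J). The finiteness of X/Y is a conclusion, obtained from these two pieces. *)
Theorem extension_length :
  [/\ fin Y X, fin (smulm J (sfull N)) (def_top hz), fin (smulm J KN) (def_bot hz) &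
    (len (tor_bot (@augm_linear A M) J) (tor_top (@augm_linear A M) J) +
     len (tor_bot (@augm_linear A N) J) (tor_top (@augm_linear A N) J) =
     len Y X + defect hz)%N].
Proof.
have [f1 f2 ->] := tor_M_split; have [f3 f4 ->] := tor_N_split.
have lX : X0 <<= X by apply: sadd_le; [exact: ext_bot_le|move=> p []].
have [||p||f5 _ e] := len_iso (@snd_linear A FN FM) lX (proj1 f1).
- move=> x hx; rewrite /tor_bot -snd_ext_ker -simg_smulm; split.
    move=> [y [k [hy [_ hk] ->]]]; exists y => //=.
    by rewrite (hk : k.2 = 0) addr0.
  move=> [y hy e]; exists y, (x - y); split=> //; last by rewrite addrC subrK.
  split; first by apply: smodB => //; apply: ext_bot_le.
  by rewrite /= e subrr.
- by move=> x hx; exists x.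
- by move=> [x hx ->]; exists x => //; rewrite subrr; exact: smod0.
- by right.
have [f6 e6] := len_add f4 f5.
by split=> //; rewrite e6 -e /defect (addnC (len (smulm J KN) _)) addnACA (addnC (len X0 X)).
Qed.

End OneCocycle.

Section Subadditive.
Variables (z z1 z2 : free_mod A (syz M) -> N) (phi : FM -> N) (c : A).
Hypotheses (hz : linear z) (hz1 : linear z1) (hz2 : linear z2) (hphi : linear phi).
Hypothesis zE : forall y, z y = c *: z1 y + z2 y + phi (res_d y).

Lemma def_top_sub : def_top hz <<= sadd (def_top hz1) (def_top hz2).
Proof.
apply: sadd_le; first by move=> n hn; apply: sadd_l; apply: sadd_l.
move=> _ [y hy ->]; rewrite zE; apply: smodD; last first.
  do 2!apply: sadd_l.
  by apply: (smulm_mono _ _ (smulm_img hphi hy)).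
apply: smodD.
  by apply: sadd_l; apply: smodZ; apply: sadd_r; exists y.
by apply: sadd_r; apply: sadd_r; exists y.
Qed.

(** Let psi lift [phi] to F(N). For a generator j (a0, b0) with b0 = d y, pick a1 and a2 over z1 y
    and z2 y; then a0 - (c a1 + a2 + psi b0) lies in KN. The predicate [P] states this decomposition
    in a form stable under sums. At (a, 0) the shared second component vanishes, so a1 and a2 land
    in the two smaller [def_bot]. *)
Lemma def_bot_sub : def_bot hz <<= sadd (def_bot hz1) (def_bot hz2).
Proof.
have [psi lpsi epsi] := projective_free (@augm_linear A N) hphi (fun x => augm_surj _).
have P : is_smod (fun p : FE => exists a1 a2, [/\ smulm J (ext_ker hz1) (a1, p.2),
    smulm J (ext_ker hz2) (a2, p.2) & smulm J KN (p.1 - (c *: a1 + a2 + psi p.2))]).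
  split=> [|a p q [a1 [a2 [h1 h2 h3]]] [b1 [b2 [k1 k2 k3]]]].
    exists 0, 0; split; [exact: (smod0 (smulm J (ext_ker hz1)))|
      exact: (smod0 (smulm J (ext_ker hz2)))|].
    by rewrite (linear_0 lpsi) scaler0 !addr0 subr0; exact: (smod0 (smulm J KN)).
  exists (a *: a1 + b1), (a *: a2 + b2); split; [exact: (smodL a h1 k1)|exact: (smodL a h2 k2)|].
  have -> : (a *: p + q).1 - (c *: (a *: a1 + b1) + (a *: a2 + b2) + psi (a *: p + q).2)
    = a *: (p.1 - (c *: a1 + a2 + psi p.2)) + (q.1 - (c *: b1 + b2 + psi q.2)).
    rewrite /= lpsi scalerBr [RHS]addrACA -opprD; congr (_ - _).
    rewrite !scalerDr !scalerA (mulrC c a) [RHS]addrACA; congr (_ + _).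
    exact: addrACA.
  exact: smodL.
move=> a ha; suff [a1 [a2 [h1 h2 h3]]] : (Smod P) (a, 0).
  have {h3} h3 : smulm J KN (a - (c *: a1 + a2)).
    by move: h3; rewrite (linear_0 lpsi) addr0.
  have -> : a = (c *: a1 + (a - (c *: a1 + a2))) + a2.
    by rewrite addrAC addrC subrK.
  exists (c *: a1 + (a - (c *: a1 + a2))), a2; split=> //.
  by apply: (@smodL _ _ (def_bot hz1)) => //; apply: def_bot_ge.
move: ha; apply: (@smulm_le _ _ _ _ (Smod P)) => j [a0 b0] hj [y hy e].
have [a1 ha1] := augm_surj (z1 y); have [a2 ha2] := augm_surj (z2 y).
exists (j *: a1), (j *: a2); split.
- have -> : (j *: a1, (j *: (a0, b0)).2) = j *: (a1, b0) :> FE by [].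
  by apply: smulm_mem => //; exists y.
- have -> : (j *: a2, (j *: (a0, b0)).2) = j *: (a2, b0) :> FE by [].
  by apply: smulm_mem => //; exists y.
- have -> : (j *: (a0, b0)).1 - (c *: (j *: a1) + j *: a2 + psi (j *: (a0, b0)).2) =
      j *: (a0 - (c *: a1 + a2 + psi b0)).
    by rewrite /= (linear_Z _ _ lpsi) !(scalerBr, scalerDr) !scalerA (mulrC c).
  apply: smulm_mem => //; rewrite /sker /=; have lN := @augm_linear A N.
  rewrite (linear_B _ _ lN) !(linear_D _ _ lN) (linear_Z _ _ lN) ha1 ha2 epsi.
  by rewrite [X in X - _]e zE hy subrr.
Qed.

Lemma defect_sub :
  fin (smulm J (sfull N)) (def_top hz1) -> fin (smulm J KN) (def_bot hz1) ->
  fin (smulm J (sfull N)) (def_top hz2) -> fin (smulm J KN) (def_bot hz2) ->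
  (defect hz <= defect hz1 + defect hz2)%N.
Proof.
move=> f1 g1 f2 g2; have [f3 l1] := len_sadd f1 f2; have [g3 l2] := len_sadd g1 g2.
have [_ l3] := fin_mono (@sle_refl _ _ _) (@sadd_l _ _ (smulm J (sfull N)) _) def_top_sub f3.
have [_ l4] := fin_mono (@sle_refl _ _ _) (@def_bot_ge z hz) def_bot_sub g3.
by rewrite /defect addnACA leq_add // ?(leq_trans l3) ?(leq_trans l4).
Qed.

End Subadditive.

Lemma zero_linear (V W : lmodType A) : linear (fun _ : V => 0 : W).
Proof. by move=> a x y; rewrite scaler0 addr0. Qed.

(** A coboundary is compared by [defect_sub] with the zero cocycle, for which both images vanish. *)
Lemma defect_coboundary z (hz : linear z) (phi : FM -> N) : linear phi ->
  (forall y, z y = phi (res_d y)) -> defect hz = 0%N.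
Proof.
move=> hphi zE; pose h0 := @zero_linear (free_mod A (syz M)) N.
have t0 : def_top h0 <<= smulm J (sfull N).
  by apply: sadd_le => // _ [y _ ->]; exact: smod0.
have b0 : def_bot h0 <<= smulm J KN.
  move=> a /(smulm_img (@fst_linear A FN FM)); apply: smulm_mono => // _ [p [y _ e] ->].
  exact: e.
have [f1 e1] := len_eq0 (@sadd_l _ _ _ _) t0.
have [f2 e2] := len_eq0 (@def_bot_ge _ h0) b0.
have : (defect hz <= defect h0 + defect h0)%N.
  apply: (defect_sub (c := 0) hz hphi) => // y.
  by rewrite zE scaler0 !add0r.
by rewrite {2 3}/defect e1 e2 leqn0 => /eqP.
Qed.

End Defect.

(** * Cocycles and the extensions that they represent *)

Section Pushout.
Variables (A : comNzRingType).
Implicit Types V W M N : lmodType A.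

Lemma linear_quot V W (f : V -> W) (hf : linear f) (S : smod V) : S <<= sker hf ->
  exists2 f' : quotmod (sub_of S) -> W, linear f' & forall x, f' (qproj _ x) = f x.
Proof.
move=> hS.
have /choice [f' hf'] : forall q : quotmod (sub_of S), exists w, forall x,
    qproj (sub_of S) x = q -> f x = w.
  move=> q; have [x <-] := qproj_surj q; exists (f x) => y /eqP.
  rewrite qproj_eq => /mem_sub_of /hS; rewrite /sker /= (linear_B _ _ hf) => /eqP.
  by rewrite subr_eq0 => /eqP.
have f'E x : f' (qproj _ x) = f x by rewrite -(hf' _ x).
exists f' => // a q r; have [x <-] := qproj_surj q; have [y <-] := qproj_surj r.
by rewrite -linearP /= !f'E hf.
Qed.

Definition lin_of V W (f : V -> W) (hf : linear f) : {linear V -> W} :=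
  HB.pack f (GRing.isLinear.Build A V W *:%R f hf).

Lemma hom_linear V W (f : Defs.hom V W) : linear (hom_fun f).
Proof. by have /asboolP := valP (f : submod (@linear_pred A V W)). Qed.

Lemma hom_funL V W a (f g : Defs.hom V W) x :
  hom_fun (a *: f + g) x = a *: hom_fun f x + hom_fun g x.
Proof.
exact: (congr1 (fun h : V -> W => h x)
  (@submod_val_is_linear A (V -> W) (@linear_pred A V W) a f g)).
Qed.

Section Cocycles.
Variables M N : lmodType A.
Local Notation Zc := (submod (ker_mod (@hom_d A (syz M) N))).

Definition cocycle (z : Zc) : free_mod A (syz M) -> N := hom_fun (val z).

Lemma cocycle_linear (z : Zc) : linear (cocycle z).
Proof. exact: hom_linear. Qed.

Lemma cocycle_res_d (z : Zc) u : cocycle z (res_d u) = 0.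
Proof. by have /eqP /(congr1 (fun h => hom_fun h u)) := valP z. Qed.

Definition cocycle_class (z : Zc) : Ext1 M N :=
  qproj (@trace_submod A _ (ker_mod (hom_d (syz M) N)) (im_mod (hom_d M N))) z.

Lemma cocycleP a (z z' : Zc) y :
  cocycle (a *: z + z') y = a *: cocycle z y + cocycle z' y.
Proof.
have e := @submod_val_is_linear A _ (ker_mod (@hom_d A (syz M) N)) a z z'.
apply: etrans (congr1 (fun h => hom_fun h y) e) _.
exact: hom_funL.
Qed.

Lemma cocycle_classP (z z' : Zc) : cocycle_class z = cocycle_class z' ->
  exists2 phi : free_mod A M -> N, linear phi &
    forall y, cocycle z y = cocycle z' y + phi (res_d y).
Proof.
move=> /eqP; rewrite /cocycle_class qproj_eq => /asboolP [phi e].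
exists (hom_fun phi); first exact: hom_linear.
move=> y; have e' : hom_fun phi (res_d y) = cocycle (z - z') y.
  by rewrite /cocycle -e.
rewrite e' addrC -[z - z']addrC -scaleN1r cocycleP scaleN1r addrAC addNr add0r.
by [].
Qed.

Lemma cocycle_class_linear : linear cocycle_class.
Proof. by move=> a z z'; rewrite /cocycle_class linearP. Qed.

Lemma cocycle_class_surj alpha : exists z, cocycle_class z = alpha.
Proof. exact: qproj_surj. Qed.

(* The pushout of F(M) along the cocycle. *)
Lemma extension_exists (alpha : Ext1 M N) : exists S : extension M N, represents S alpha.
Proof.
have [z ze] := cocycle_class_surj alpha.
pose FM := free_mod A M; have hz := cocycle_linear z.
(* The sign makes (0, d y) equal to (z y, 0) in the quotient, as [represents] demands. *)
have P : is_smod (fun p : (N * FM)%type => exists y, p.1 = - cocycle z y /\ p.2 = res_d y).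
  split=> [|a p q [y [e1 e2]] [y' [e1' e2']]].
    exists 0; split; first by rewrite (linear_0 hz) oppr0.
    by rewrite (linear_0 (@res_d_linear A M)).
  exists (a *: y + y'); split.
    by rewrite hz opprD -scalerN -e1 -e1'.
  by rewrite res_d_linear -e2 -e2'.
pose T := Smod P; pose E := quotmod (sub_of T).
have lq : linear (qproj (sub_of T)) by move=> a x y; rewrite linearP.
have l2 := linear_comp (@augm_linear A M) (@snd_linear A N FM).
have kT : T <<= sker l2.
  by move=> p [y [_ e]]; rewrite /sker /= e; apply/res_d_exact; exists y.
have [s ls sE] := linear_quot kT.
have lj := linear_comp lq (@pair_l_linear A N FM).
have lg := linear_comp lq (@pair_r_linear A N FM).
have q0 p : qproj (sub_of T) p = 0 <-> T p.
  by split=> [/eqP|/mem_sub_of h]; [rewrite qproj_eq0 => /mem_sub_of|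
    apply/eqP; rewrite qproj_eq0].
have z0 y : res_d y = 0 :> FM -> cocycle z y = 0.
  by move=> /res_d_eq0 /res_d_exact [u <-]; apply: cocycle_res_d.
have inj : injective (lin_of lj).
  move=> x x' /eqP; rewrite -subr_eq0 -linearB => /eqP /q0 [y /= [e1 e2]].
  by apply/eqP; rewrite -subr_eq0 e1 z0 ?oppr0.
have surj x : exists e, lin_of ls e = x.
  by have [u <-] := augm_surj x; exists (qproj _ (0, u)); rewrite /= sE.
have ex e : lin_of ls e = 0 <-> exists y, lin_of lj y = e.
  have [[n u] <-] := qproj_surj e; rewrite /= sE /=; split.
    move=> /res_d_exact [y hy]; exists (n + cocycle z y).
    apply/eqP; rewrite -subr_eq0 -(linear_B _ _ lq); apply/eqP/q0.
    exists (- y); rewrite (linear_N _ hz) (linear_N _ (@res_d_linear A M)) hy opprK.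
    by split; [rewrite /= addrAC subrr add0r|exact: sub0r].
  case=> y /eqP; rewrite -subr_eq0 -(linear_B _ _ lq) => /eqP /q0 [w /= [_ e2]].
  apply/res_d_exact; exists (- w); rewrite (linear_N _ (@res_d_linear A M)) -e2.
  by rewrite sub0r opprK.
exists (Extension inj surj ex), z => //; exists (lin_of lg); split=> [x|y] /=.
  by rewrite sE.
apply/eqP; rewrite -subr_eq0 -(linear_B _ _ lq); apply/eqP/q0; exists y.
by rewrite /= sub0r subr0.
Qed.

(** The map is (a, b) |-> i (augm a) - g b. If it vanishes, applying the surjection to M shows augm
    b = 0, so b = d y, and injectivity of i gives augm a = z y. Hence the kernel depends on the
    cocycle alone. *)
Lemma extension_presentation (S : extension M N) (alpha : Ext1 M N) :
  represents S alpha -> exists2 z, cocycle_class z = alpha &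
  exists pi : (free_mod A N * free_mod A M)%type -> ext_mod S, exists hpi : linear pi,
    (forall e, exists p, pi p = e) /\ sker hpi = ext_ker (cocycle_linear z).
Proof.
case: S => E i s inj surj ex [z ze [g [/= gs gz]]]; exists z => //.
pose pi (p : (free_mod A N * free_mod A M)%type) := i (augm p.1) - g p.2.
have hpi : linear pi.
  have li : linear i by move=> a x y; rewrite linearP.
  have lg : linear g by move=> a x y; rewrite linearP.
  by move=> a p q; rewrite /pi /= augm_linear li lg scalerBr opprD addrACA.
exists pi, hpi; split=> [e|].
  have [b hb] := augm_surj (s e).
  have /ex [n hn] : s (e - g b) = 0 by rewrite linearB gs hb subrr.
  have [a ha] := augm_surj n.
  by exists (a, - b); rewrite /pi /= ha hn linearN opprK subrK.
have si n : s (i n) = 0 by apply/ex; exists n.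
apply: smod_ext => -[a b]; rewrite /sker /= /pi /=.
  move=> /eqP; rewrite subr_eq0 => /eqP e.
  have /res_d_exact [y hy] : augm b = 0 by rewrite -gs -e si.
  by exists y => //; apply: (inj); rewrite e -hy gz.
by case=> y /= <- ->; rewrite gz subrr.
Qed.

Lemma fin_gen_ext (S : extension M N) : fin_gen M -> fin_gen N -> fin_gen (ext_mod S).
Proof.
case: S => E i s inj surj ex /= [sM hM] [sN hN].
have /choice [l hl] := surj.
exists ([seq i n | n <- sN] ++ [seq l x | x <- sM]) => e.
apply/idP/idP => // _; apply/mem_gen; set r := _ ++ _.
have li : linear i by move=> a x y; rewrite linearP.
have ls : linear s by move=> a x y; rewrite linearP.
have iN n : sspan r (i n).
  have /esym : n \in @full_mod A N by [].
  rewrite hN => /esym /mem_gen; apply: (_ : sspan sN <<= spre li (sspan r)).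
  apply: shull_le => x xs; apply: shull_mem; rewrite mem_cat.
  by apply/orP; left; apply: map_f.
have /esym : s e \in @full_mod A M by [].
rewrite hM => /esym /mem_gen h.
have [f hf e'] : simg ls (sspan r) (s e).
  apply: h => x xs; exists (l x); last by rewrite hl.
  by apply: shull_mem; rewrite mem_cat; apply/orP; right; apply: map_f.
have /ex [n hn] : s (e - f) = 0 by rewrite linearB e' subrr.
by apply: (@smodBD _ _ (sspan r) e f) => //; rewrite -hn.
Qed.

End Cocycles.
End Pushout.

(** * The invariant *)

Section Invariant.
Variables (R : realType) (A : comNzRingType) (m : submodClosed A^o) (d : nat).
Hypotheses (hloc : noetherian_local m) (hdim : krull_dim A d) (hd : (1 <= d)%N).
Hypothesis hCM : cohen_macaulay m.
Variables (I : submodClosed A^o) (F : int -> submodClosed A^o).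
Hypotheses (hI : primary_to m I) (hF : admissible I F).

Local Notation J n := (sm_of (F n.+1%:Z)).
Local Notation norm n := ((d.-1)`!%:R / n%:R ^+ d.-1 : R).
Local Notation tor V n :=
  (len (tor_bot (@augm_linear A V) (J n)) (tor_top (@augm_linear A V) (J n))).

Lemma noeth_regular : noeth (A^o : lmodType A).
Proof. by case: hloc => /noetherianP. Qed.

(** If g^k lies in the ideal of [ys], then g^(k n) lies in its n-th power, so every generator of m
    acts nilpotently on the quotient. *)
Lemma fin_filtration (V : lmodType A) (ys : seq A) : noeth V ->
  (forall g : A, sm_of m g -> exists k, sspan (ys : seq A^o) (g ^+ k)) ->
  forall (S : smod V) n, fin (powm (sspan (ys : seq A^o)) n S) S.
Proof.
move=> nV hys S n; have [gs hgs] := noeth_regular (sm_of m).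
apply: (fin_powers (max_unit hloc) nV (gs := gs) (rest := [::])) => //.
- exact: powm_le.
- by rewrite cats0 hgs.
- move=> g hg; have [k hk] : exists k, sspan (ys : seq A^o) (g ^+ k).
    by apply: hys; rewrite hgs; apply: shull_mem.
  exists (k * n)%N => z Sz; elim: n => [|n IHn]; first by rewrite muln0 expr0 scale1r.
  by rewrite mulnS exprD -scalerA; apply: smulm_mem.
Qed.

(** [ep_filt] is applied to the kernel of a noetherian presentation, with parameters for the smaller
    ideal Q; there are d of them, whence the order. *)
Lemma tor_growth (V : lmodType A) : fin_gen V ->
  (forall n, fin (tor_bot (@augm_linear A V) (J n)) (tor_top (@augm_linear A V) (J n))) /\
  ep d (fun n => (tor V n)%:Z).
Proof.
move=> [s hs]; have nA := noeth_regular.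
have [P [pi [lpi pP nP hpi]]] := presentation s nA.
have spi v : exists x, pi x = v.
  by apply: hpi; apply/mem_gen; rewrite -hs.
have [ys [sys QI hys]] := parameters_exist hloc hdim hCM hI.
have [xs hxs] := noeth_regular (sm_of I).
have fQ := fin_filtration nP hys (sker lpi).
have d0 : (0 < size ys)%N by rewrite sys.
have QI' : sspan (ys : seq A^o) <<= sspan (xs : seq A^o) by rewrite -hxs.
have [hF1 hF2 [n0 hF3]] := hF.
have IF n : ipow (sspan (xs : seq A^o)) n.+1 <<= J n.
  rewrite -hxs -sm_of_pow => x hx; exact: (hF1 n.+1%:Z).
have FI n : smulm (sspan (xs : seq A^o)) (J n) <<= J n.+1.
  rewrite -hxs; apply: smulm_le => a x ha hx.
  have -> : n.+2%:Z = 1 + n.+1%:Z by lia.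
  apply: hF2 => //; apply: (hF1 1).
  suff : sm_of (ideal_pow I 1) a by [].
  by rewrite sm_of_pow -[a]mulr1; exact: (smulm_mem (S := sfull A^o) ha).
have FE : exists n1, forall n, (n1 <= n)%N ->
    J n.+1 = smulm (sspan (xs : seq A^o)) (J n).
  exists `|n0|%N => n hn; rewrite -hxs -sm_of_smul.
  have h := hF3 n.+2%:Z; have e : n.+2%:Z - 1 = n.+1%:Z by lia.
  rewrite e in h.
  by apply: smod_ext => x /=; rewrite h //; lia.
have fF := fin_Zn QI' fQ IF.
have ept := ep_filt nP QI' fQ d0 IF FI FE.
(* The lengths move from the noetherian presentation to the standard one, from which [Tor1] is
   built. *)
have cmp n := @tor_compare_eq _ _ _ _ _ _ (@augm_linear A V) lpi (J n) (projective_free (X := V)) pP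
  (@augm_surj A V) spi (fF n).
split=> [n|]; first by case: (cmp n).
rewrite -sys; apply: ep_ext ept; exists 0%N => n _.
by have [_ ->] := cmp n.
Qed.

Lemma eT_cvg (V : lmodType A) : fin_gen V -> exists c : int,
  (fun n => norm n * (tor V n)%:R) @ \oo --> (c%:~R : R) /\ eT R F d V = c%:~R.
Proof.
move=> hV; have [fV eV] := tor_growth hV.
have [c hc] := ep_lim R hd eV; exists c; split=> //.
rewrite /eT (_ : (fun n : nat => _) = (fun n => norm n * (tor V n)%:R : R)).
  exact: cvg_lim hc.
by apply/funext => n; rewrite length_Tor1.
Qed.

Variables M N : lmodType A.
Hypotheses (hM : fin_gen M) (hN : fin_gen N).

Local Notation e alpha := (eT_ext R F d (alpha : Ext1 M N)).
Local Notation def z n := (defect (J n) (cocycle_linear z)).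

(** Whichever extension [xget] selects, it presents some cocycle of the class, and
    [extension_length] turns the three limits into one limit of normalized defects. The pushout
    ensures that the default value of [xget] does not occur. *)
Lemma eT_ext_spec (alpha : Ext1 M N) : exists z, [/\ cocycle_class z = alpha,
  exists c : int, e alpha = c%:~R &
  (fun n => norm n * (def z n)%:R) @ \oo --> e alpha].
Proof.
have [S rS eS] : [set v | exists2 S : extension M N, represents S alpha &
    v = eT R F d M + eT R F d N - eT R F d (ext_mod S)] (e alpha).
  have [S rS] := extension_exists alpha.
  by apply: xgetPex; exists (eT R F d M + eT R F d N - eT R F d (ext_mod S)); exists S.
have [z ze [pi [hpi [spi kpi]]]] := extension_presentation rS.
have [cM [lM eM]] := eT_cvg hM; have [cN [lN eN]] := eT_cvg hN.
have hE := fin_gen_ext S hM hN; have [cE [lE eE]] := eT_cvg hE.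
exists z; split=> //; first by exists (cM + cN - cE); rewrite eS eM eN eE rmorphB rmorphD.
rewrite eS eM eN eE.
rewrite (_ : (fun n : nat => _) = (fun n => norm n * (tor M n)%:R + norm n * (tor N n)%:R
    - norm n * (tor (ext_mod S) n)%:R)).
  by apply: cvgB => //; apply: cvgD.
apply/funext => n.
have [f1 f2 f3 E] := extension_length (cocycle_linear z) (@cocycle_res_d _ _ _ z)
  ((tor_growth hM).1 n) ((tor_growth hN).1 n).
have [_ <-] := @tor_compare_eq _ _ _ _ _ _ hpi (@augm_linear A (ext_mod S)) (J n)
  (projective_prod (projective_free (X := N)) (projective_free (X := M)))
  (projective_free (X := ext_mod S)) spi (@augm_surj A _) ((tor_growth hE).1 n).
rewrite -mulrDr -natrD E natrD -mulrBr /tor_bot /tor_top kpi; congr (_ * _).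
by rewrite addrAC subrr add0r.
Qed.

Lemma norm_ge0 n : 0 <= norm n.
Proof. by rewrite divr_ge0 // exprn_ge0. Qed.

(** Integrality comes from the three values of e^T, nonnegativity from the defects. *)
Lemma eT_ext_nat alpha : exists n : nat, e alpha = n%:R.
Proof.
have [z [_ [c hc] lz]] := eT_ext_spec alpha.
have : 0 <= e alpha.
  rewrite -(cvg_lim _ lz) //; apply: limr_ge; first by apply/cvg_ex; eexists; exact: lz.
  by apply: nearW => n; rewrite mulr_ge0 ?norm_ge0.
rewrite hc; case: c {hc} => n; first by exists n.
by rewrite ler0z.
Qed.

Lemma fin_defect (z : submod (ker_mod (@hom_d A (syz M) N))) n :
  fin (smulm (J n) (sfull N)) (def_top (J n) (cocycle_linear z)) /\
  fin (smulm (J n) (sker (@augm_linear A N))) (def_bot (J n) (cocycle_linear z)).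
Proof.
by have [_ f g _] := extension_length (cocycle_linear z) (@cocycle_res_d _ _ _ z)
  ((tor_growth hM).1 n) ((tor_growth hN).1 n).
Qed.

(** The three cocycles come from independent choices, so the first agrees with a z1 + z2 only up to
    a coboundary, given by [phi]. *)
Lemma eT_ext_sub a (alpha beta : Ext1 M N) :
  e (a *: alpha + beta) <= e alpha + e beta.
Proof.
have [z [ze _ lz]] := eT_ext_spec (a *: alpha + beta).
have [z1 [ze1 _ lz1]] := eT_ext_spec alpha; have [z2 [ze2 _ lz2]] := eT_ext_spec beta.
have [phi lphi zE] : exists2 phi : free_mod A M -> N, linear phi &
    forall y, cocycle z y = cocycle (a *: z1 + z2) y + phi (res_d y).
  by apply: cocycle_classP; rewrite cocycle_class_linear ze ze1 ze2.
have lD : (fun n => norm n * (def z1 n)%:R + norm n * (def z2 n)%:R) @ \oo -->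
    e alpha + e beta by apply: cvgD.
rewrite -(cvg_lim _ lz) // -(cvg_lim _ lD) //; apply: ler_lim.
- by apply/cvg_ex; eexists; exact: lz.
- by apply/cvg_ex; eexists; exact: lD.
apply: nearW => n /=; rewrite -mulrDr ler_wpM2l ?norm_ge0 // -natrD ler_nat.
have [f1 g1] := fin_defect z1 n; have [f2 g2] := fin_defect z2 n.
have zE' y : cocycle z y = a *: cocycle z1 y + cocycle z2 y + phi (res_d y).
  by rewrite zE cocycleP.
exact: (@defect_sub A M N (J n) _ _ _ phi a (cocycle_linear z) (cocycle_linear z1)
  (cocycle_linear z2) lphi zE' f1 g1 f2 g2).
Qed.

Lemma eT_ext0 : e 0 = 0.
Proof.
have [z [ze _ lz]] := eT_ext_spec 0.
have [phi lphi zE] : exists2 phi : free_mod A M -> N, linear phi &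
    forall y, cocycle z y = cocycle 0 y + phi (res_d y).
  by apply: cocycle_classP; rewrite ze (linear_0 (@cocycle_class_linear _ _ _)).
rewrite -(cvg_lim _ lz) //; apply: cvg_lim => //.
rewrite (_ : (fun n : nat => _) = fun=> 0); first exact: cvg_cst.
apply/funext => n; rewrite (defect_coboundary (J n) (cocycle_linear z) lphi) ?mulr0 //.
by move=> y; rewrite zE; exact: add0r.
Qed.

End Invariant.

Lemma proj_class_eq (K : fieldType) (A : comNzRingType) (iota : {rmorphism K -> A})
    (V : lmodType A) (S : submodClosed V) (x y : V) (Sx : x \notin S) (Sy : y \notin S) :
  proj_class iota Sx = proj_class iota Sy -> exists c, x - iota c *: y \in S.
Proof.
move=> /(congr1 sval) /= E.
have [c _ hc] : [set c *: (qproj S y : restr_scal iota (quotmod S)) | c in [set: K]]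
    (qproj S x : restr_scal iota (quotmod S)).
  by rewrite -E; exists 1 => //; rewrite scale1r.
exists c; rewrite -qproj_eq linearZ /=; apply/eqP; exact: esym hc.
Qed.

Theorem theorem1p15 (R : realType)
    (A : comNzRingType) (m : submodClosed A^o) (d : nat)
    (hloc : noetherian_local m)
    (hunram : is_reduced (adic_completion m))
    (hdim : krull_dim A d) (hd : (1 <= d)%N)
    (hCM : cohen_macaulay m)
    (hres : ~ countable [set: quot_ring m] \/ perfect (quot_ring m))
    (I : submodClosed A^o) (hI : primary_to m I)
    (F : int -> submodClosed A^o) (hF : admissible I F)
    (hF1 : [set` F 1] = integral_closure I)
    (hFn : exists n0 : int, forall n : int, n0 <= n ->
       [set` F n] = integral_closure (ideal_powz I n))
    (M N : lmodType A)
    (hM : max_cohen_macaulay m M) (hN : max_cohen_macaulay m N)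
    (p : nat) (hp : p \in [pchar A])
    (k : fieldType) (iota : {rmorphism k -> A})
    (hk : exists f : {rmorphism k -> quot_ring m}, bijective f)
    (hT : T_split R F d M N <> [set: Ext1 M N]) :
  exists2 T : submodClosed (Ext1 M N),
    [set` T] = T_split R F d M N &
    exists ebar : proj_space (restr_scal iota (quotmod T)) ->
                  {n : nat | (0 < n)%N},
      forall (alpha : Ext1 M N) (Talpha : alpha \notin T),
        eT_ext R F d alpha = (val (ebar (proj_class iota Talpha)))%:R.
Proof.
have [gM _] := hM; have [gN _] := hN.
have e_nat := eT_ext_nat R hloc hdim hd hCM hI hF gM gN.
have e_sub := eT_ext_sub R hloc hdim hd hCM hI hF gM gN.
have e_ge0 alpha : 0 <= eT_ext R F d (alpha : Ext1 M N).
  by have [n ->] := e_nat alpha; rewrite ler0n.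
have P : is_smod (fun alpha : Ext1 M N => eT_ext R F d alpha = 0).
  split=> [|a x y ex ey]; first exact: (eT_ext0 R hloc hdim hd hCM hI hF gM gN).
  by apply/eqP; rewrite eq_le e_ge0 andbT -[leRHS](addr0 0) -{1}ex -ey e_sub.
pose T := sub_of (Smod P).
(* Write x as c y plus an element of T; the latter adds nothing by subadditivity. No assumption on c
   is made, since the reverse inequality will use another scalar. *)
have coset x y c : x - iota c *: y \in T -> eT_ext R F d x <= eT_ext R F d y.
  move=> /mem_sub_of /= e0; have := e_sub (iota c) y (x - iota c *: y).
  by rewrite addrC subrK e0 addr0.
exists T; first by apply/seteqP; split=> x; case: (mem_sub_of (Smod P) x) => h1 h2 hx;
    [apply: h1|apply: h2].
have /choice [ebar hebar] : forall L : proj_space (restr_scal iota (quotmod T)),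
    exists n : {n : nat | (0 < n)%N}, forall x (Tx : x \notin T),
      proj_class iota Tx = L -> eT_ext R F d x = (val n)%:R.
  move=> L; have [[x [Tx xL]]|nL] :=
    pselect (exists x, exists Tx : x \notin T, proj_class iota Tx = L); last first.
    (* A point not given by any x outside T imposes no condition; 1 is an arbitrary positive
       value. *)
    exists (exist _ 1%N isT) => x Tx xL; case: nL; by exists x, Tx.
  have [n en] := e_nat x.
  have n0 : (0 < n)%N.
    rewrite lt0n; apply: (contraNneq _ (Tx)) => n0; apply/mem_sub_of => /=.
    by rewrite en n0.
  exists (exist _ n n0) => y Ty yL /=; rewrite -en; apply/eqP; rewrite eq_le.
  (* Equality of the two lines is used in both directions, with scalars c and c', to get both
     inequalities. *)
  have /proj_class_eq [c hc] : proj_class iota Tx = proj_class iota Ty by rewrite xL.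
  have /proj_class_eq [c' hc'] : proj_class iota Ty = proj_class iota Tx by rewrite xL.
  by rewrite (coset _ _ _ hc) (coset _ _ _ hc').
by exists ebar => x Tx; apply: hebar.
Qed.
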